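(* Let $Z\in\mathbb{C}$. A fundamental solution of the differential operator $\mathcal A|_{\kappa=0}=\Delta_3+\frac{2Z}{r}$ on $\mathbb{R}^3$ is given by $\mathrm{Pf.}\,k_{\mathcal A}(Z,0,r)$, where $k_{\mathcal A}(Z,0,r)$ is the function $k_{\mathcal A}(Z,\kappa,r)$ taken at $\kappa=0$, i.e. $$k_{\mathcal A}(Z,0,r)=-\frac1{4\pi r}\left[1-2Zr\ln(r)+\sum_{p=2}^\infty\frac{(-1)^p2^pZ^p}{p!\,(p-1)!}\,r^p\bigl(\ln(r)-(H_p+H_{p-1}-1)\bigr)\right],$$ with $H_p:=\sum_{k=1}^p\frac1k$ the $p$-th harmonic number. That is, $\mathcal A|_{\kappa=0}\,\mathrm{Pf.}\,k_{\mathcal A}(Z,0,\cdot)=\delta$ in $\mathcal D'(\mathbb{R}^3)$. Furthermore, $k_{\mathcal H}(r)=-2\,k_{\mathcal A}(Z,0,r)$ is a fundamental solution of the corresponding Hamiltonian $\mathcal H=-\frac12\Delta_3-\frac Zr$, i.e. $\mathcal H\,\mathrm{Pf.}\,k_{\mathcal H}=\delta$.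
   Context: $r=|x|$ on $\mathbb{R}^3$. For a function $k$ on $\mathbb{R}^3\setminus\{0\}$ that is locally integrable on $\mathbb{R}^3$, $\mathrm{Pf.}\,k$ is the corresponding regular distribution. The operator is $$\mathcal A=-2(\mathcal H+\kappa^2)=\Delta_3+\frac{2Z}r-2\kappa^2,$$ in polar coordinates $r^{-2}[(-r\partial_r)^2-(-r\partial_r)+\Delta_{S^2}+2Zr-2\kappa^2r^2]$, where $\mathcal H=-\frac12\Delta_3-\frac Zr$ is the Hamiltonian of an electron interacting with a nucleus of charge $Z$. For radial $k$, $\mathcal A\,\mathrm{Pf.}\,k$ is the distribution $g\mapsto\int_{\mathbb{R}^3}(\mathcal Ag)(x)\,k(|x|)\,dx$, $g\in\mathcal D(\mathbb{R}^3)$ (and similarly for $\mathcal H$). **Binary words.** A binary word is a finite sequence $\alpha=(\alpha_1,\dots,\alpha_{N^\alpha})$ with $\alpha_i\in\{1,2\}$; $N^\alpha_Z$ and $N^\alpha_\kappa$ are the numbers of 1's and 2's. $S_p$ is the set of binary words with $\sum_k\alpha_k=p$ ($S_0$ consists of the empty word). $S_{p-1}\lfloor_1$ and $S_{p-2}\lfloor_2$ denote the sets of words obtained by appending a 1, respectively a 2, at the end of each word of $S_{p-1}$, respectively $S_{p-2}$; they consist of the words in $S_p$ ending in 1, respectively 2. For $\alpha\in S_p$ put $p_0=p$, $p_j=p-\sum_{k=1}^j\alpha_k$. **The function $k_{\mathcal A}$.** $k_{\mathcal A}(Z,\kappa,r)=\sum_{p=0}^\infty r^pk_p(r)$, with $k_0(r)=-\frac1{4\pi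 r}$, $k_1(r)=\frac1{4\pi r}2Z\ln(r)$ and for $p\ge2$ $$\begin{aligned}k_p(r)=&-\frac1{4\pi r}\sum_{\alpha\in S_{p-2}\lfloor_2}(-1)^{N_Z^\alpha}2^{N^\alpha}Z^{N_Z^\alpha}(\kappa^2)^{N_\kappa^\alpha}\prod_{j=0}^{N^\alpha-1}\frac1{p_j(p_j-1)}\\&-\frac1{4\pi r}\sum_{\alpha\in S_{p-1}\lfloor_1}(-1)^{N_Z^\alpha}2^{N^\alpha}Z^{N_Z^\alpha}(\kappa^2)^{N_\kappa^\alpha}\prod_{j=0}^{N^\alpha-2}\frac1{p_j(p_j-1)}\Bigl[\ln(r)-\sum_{j=0}^{N^\alpha-2}\Bigl(\frac1{p_j-1}+\frac1{p_j}\Bigr)\Bigr].\end{aligned}$$ *)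

(* Defs.v *)
From HB Require Import structures.
From mathcomp Require Import all_boot all_order all_algebra.
From mathcomp Require Import complex.
From mathcomp Require Import all_classical all_reals all_analysis.
From mathcomp Require Import ring.

Set Implicit Arguments.
Unset Strict Implicit.
Unset Printing Implicit Defensive.

Import Order.TTheory GRing.Theory Num.Theory.
Import numFieldNormedType.Exports.

Local Open Scope classical_set_scope.
Local Open Scope ring_scope.
Local Open Scope complex_scope.

(** Binary words, as sequences of natural numbers equal to 1 or 2. *)

Definition words_of_size (n : nat) : seq (seq nat) :=
  [seq [seq (nat_of_ord i).+1 | i <- tval t] | t : n.-tuple 'I_2].

(* All words of weight p: such a word has at most p letters. *)
Definition S_ (p : nat) : seq (seq nat) :=
  [seq a <- flatten [seq words_of_size n | n <- iota 0 p.+1] | sumn a == p].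

Definition append_letter (l : nat) (A : seq (seq nat)) : seq (seq nat) :=
  [seq rcons a l | a <- A].

Lemma mem_words_of_size n a :
  (a \in words_of_size n) = (size a == n) && all (mem [:: 1; 2]%N) a.
Proof.
apply/idP/andP => [/fintype.imageP[t _ ->]|[/eqP <- /allP a12]].
  rewrite size_map size_tuple; split=> //; apply/allP => x /mapP[i _ ->].
  by case: i => [[|[|]]].
apply/fintype.imageP.
exists (map_tuple (fun l => inord l.-1 : 'I_2) (in_tuple a)) => //=.
rewrite -map_comp -[LHS]map_id; apply/eq_in_map => x /a12.
by rewrite !inE /= => /orP[] /eqP->; rewrite /= inordK.
Qed.

Lemma mem_S p a : (a \in S_ p) = all (mem [:: 1; 2]%N) a && (sumn a == p).
Proof.
rewrite mem_filter andbC; case: eqP => [<-|_]; rewrite ?andbT ?andbF//.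
apply/idP/idP => [/flatten_mapP[n _]|a12].
  by rewrite mem_words_of_size => /andP[].
apply/flatten_mapP; exists (size a); last by rewrite mem_words_of_size eqxx.
rewrite mem_iota add0n ltnS leq0n /=.
elim: a a12 => //= x a IH /andP[x12 /IH]; rewrite -add1n; apply: leq_add.
by move: x12; rewrite !inE => /orP[] /eqP->.
Qed.

Lemma uniq_S p : uniq (S_ p).
Proof.
apply: filter_uniq; elim: p.+1 => // n IH.
rewrite -addn1 iotaD map_cat flatten_cat /= cats0 cat_uniq IH /= add0n.
apply/andP; split.
  apply/hasPn => a; rewrite mem_words_of_size => /andP[/eqP sa _].
  apply/negP => /flatten_mapP[m]; rewrite mem_iota add0n => /andP[_ mn].
  by rewrite mem_words_of_size sa gtn_eqF.
rewrite map_inj_uniq ?enum_uniq// => s t st; apply/val_inj.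
by move: st; apply: inj_map => i j [ij]; apply/val_inj.
Qed.


Section coulomb.
Variable R : realType.
Local Notation C := R[i].
Implicit Types (Z kappa : C) (r : R) (a : seq nat).

(* p_j = p - (a_1 + ... + a_j); the truncated subtraction is exact on S_ p. *)
Definition rest (p : nat) a (j : nat) : nat := p - sumn (take j a).

Definition word_coef Z kappa a : C :=
  (-1) ^+ count_mem 1%N a * 2 ^+ size a * Z ^+ count_mem 1%N a
  * (kappa ^+ 2) ^+ count_mem 2 a.

Definition word_prod (p : nat) a (N : nat) : C :=
  \prod_(0 <= j < N) ((rest p a j)%:R * ((rest p a j)%:R - 1))^-1.

Definition word_harm (p : nat) a (N : nat) : C :=
  \sum_(0 <= j < N) (((rest p a j)%:R - 1)^-1 + (rest p a j)%:R^-1).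

(* Words in [append_letter l (S_ (p - l))] are nonempty, so [size a - 1] is
   exact; all the factors p_j, p_j - 1 met below are nonzero. *)
Definition k_ Z kappa (p : nat) r : C :=
  match p with
  | 0 => - (4 * pi * r)^-1%:C
  | 1 => (4 * pi * r)^-1%:C * (2 * Z * (ln r)%:C)
  | _ =>
    - (4 * pi * r)^-1%:C *
      (\sum_(a <- append_letter 2 (S_ (p - 2)))
         word_coef Z kappa a * word_prod p a (size a))
    - (4 * pi * r)^-1%:C *
      (\sum_(a <- append_letter 1 (S_ (p - 1)))
         word_coef Z kappa a * word_prod p a (size a - 1)
         * ((ln r)%:C - word_harm p a (size a - 1)))
  end.

(* The regular copy C^o carries the topology of the complex modulus. *)
Definition kA_series Z kappa r : nat -> C^o :=
  series (fun p : nat => r%:C ^+ p * k_ Z kappa p r).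

Definition kA Z kappa r : C := limn (kA_series Z kappa r).

Definition kH Z r : C := - 2 * kA Z 0 r.

Definition Hnum (p : nat) : R := \sum_(1 <= k < p.+1) k%:R^-1.

(* Partial sums of the series over p >= 2 in the closed form of kA Z 0 r. *)
Definition kA0_tail Z r : nat -> C^o := fun n : nat =>
  \sum_(2 <= p < n)
     ((-1) ^+ p * 2 ^+ p * Z ^+ p / ((p`!)%:R * ((p.-1)`!)%:R)
      * r%:C ^+ p * (ln r - (Hnum p + Hnum p.-1 - 1))%:C).

End coulomb.

Section distributions.
Variable R : realType.
Local Notation C := R[i].
(* The library norm of this product is the sup norm; r = |x| is [norm3]. *)
Local Notation E3 := (R * R * R)%type.

Definition norm3 (x : E3) : R :=
  Num.sqrt (x.1.1 ^+ 2 + x.1.2 ^+ 2 + x.2 ^+ 2).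

Definition basis3 (i : 'I_3) : E3 :=
  match val i with 0 => (1, 0, 0) | 1 => (0, 1, 0) | _ => (0, 0, 1) end.

Definition partials (s : seq 'I_3) (f : E3 -> R) : E3 -> R :=
  foldr (fun i h => 'D_(basis3 i) h) f s.

(* C^infinity: every iterated partial derivative exists and is continuous. *)
Definition smooth (f : E3 -> R) : Prop :=
  forall s : seq 'I_3, continuous (partials s f) /\
    forall (i : 'I_3) (x : E3), derivable (partials s f) x (basis3 i).

Definition laplacian (f : E3 -> R) : E3 -> R :=
  fun x => \sum_(i < 3) partials [:: i; i] f x.

Definition reC (g : E3 -> C) : E3 -> R := fun x => complex.Re (g x).
Definition imC (g : E3 -> C) : E3 -> R := fun x => complex.Im (g x).

(* The space D(R^3) of complex-valued test functions. *)
Definition test_function (g : E3 -> C) : Prop :=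
  [/\ smooth (reC g), smooth (imC g) &
      compact (closure [set x : E3 | g x != 0])].

Definition claplacian (g : E3 -> C) : E3 -> C :=
  fun x => laplacian (reC g) x +i* laplacian (imC g) x.

(* The coefficient Z / r takes the value 0 at the origin, a null set. *)
Definition opA (Z kappa : C) (g : E3 -> C) : E3 -> C :=
  fun x => claplacian g x + 2 * Z / (norm3 x)%:C * g x - 2 * kappa ^+ 2 * g x.

Definition opH (Z : C) (g : E3 -> C) : E3 -> C :=
  fun x => - 2^-1 * claplacian g x - Z / (norm3 x)%:C * g x.

Lemma opA_opH Z kappa g x :
  opA Z kappa g x = - 2 * (opH Z g x + kappa ^+ 2 * g x).
Proof.
rewrite /opA /opH; move: (norm3 x)%:C^-1 => s.
by field.
Qed.

(* Lebesgue measure of R^3 on the Borel sets. *)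
Definition leb3 :
    set (measurableTypeR R * measurableTypeR R * measurableTypeR R) -> \bar R :=
  ((lebesgue_measure \x lebesgue_measure) \x lebesgue_measure)%E.

Definition cintegrable (D : set E3) (f : E3 -> C) : Prop :=
  leb3.-integrable D (EFin \o reC f) /\ leb3.-integrable D (EFin \o imC f).

Definition cintegral (f : E3 -> C) : C :=
  (\int[leb3]_(x in setT) reC f x) +i* (\int[leb3]_(x in setT) imC f x).

Definition locally_integrable3 (k : E3 -> C) : Prop :=
  forall K : set E3, compact K -> cintegrable K k.

(* The pairing of k with g. It is also applied to compactly supported g that
   are singular at the origin, such as [opA Z 0 h] for a test function h;
   integrability is then required explicitly. *)
Definition Pf (k : E3 -> C) : (E3 -> C) -> C :=
  fun g => cintegral (fun x => g x * k x).

Definition delta0 : (E3 -> C) -> C := fun g => g (0, 0, 0).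

(* L (Pf. k) = delta for a radial k and a formally self-adjoint L, where
   L (Pf. k) is the functional mapping a test function g to the integral of
   (L g) k. The equality with delta shows that it is a distribution. *)
Definition fundamental_solution
    (L : (E3 -> C) -> (E3 -> C)) (k : R -> C) : Prop :=
  let kx := fun x : E3 => k (norm3 x) in
  locally_integrable3 kx /\
  forall g, test_function g ->
    cintegrable setT (fun x => L g x * kx x) /\ Pf kx (L g) = delta0 g.

End distributions.

(* Main.v *)
Require Import Defs.
From HB Require Import structures.
From mathcomp Require Import all_boot all_order all_algebra.
From mathcomp Require Import complex.
From mathcomp Require Import all_classical all_reals all_analysis.
From mathcomp Require Import measurable_realfun.
From mathcomp Require Import ring lra.

Set Implicit Arguments.
Unset Strict Implicit.
Unset Printing Implicit Defensive.

Import Order.TTheory GRing.Theory Num.Theory.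
Import numFieldNormedType.Exports.

Local Open Scope classical_set_scope.
Local Open Scope ring_scope.

(** Write k_A(Z,0,r) = - u(r) / (4 pi r). At kappa = 0 a binary word that
    contains the letter 2 has coefficient 0, so only the words 1...1 contribute
    to the series; their products and harmonic sums telescope ([k_closed]),
    which gives the closed form. It exhibits u as a Frobenius solution
    u = A(r) + r B(r) ln r, with entire power series A and B, A(0) = 1, of the
    equation u'' = - (2 Z / r) u: this is checked on the coefficients
    ([coefA_rec], [coefB_rec], [lsol_ode]). Hence for r > 0 the function u / r
    is annihilated by the operator, because the Laplacian of u(r) / r is
    u''(r) / r, and what has to be shown is that the singularity at the origin
    contributes exactly the Dirac mass.

    That is a statement about one real function ([radial_green]): let u be twice
    continuously differentiable on r > 0, with |u - u0| <= C sqrt r,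
    |u'| <= C / sqrt r and |u''| <= C / r near 0, as the logarithm allows. Then,
    for a smooth compactly supported g,
      int (Delta g) u / r - g u'' / r = - 4 pi u0 g(0).
    Instead of cutting out a ball and computing a surface integral, the radius
    is regularised to s = sqrt (e + r^2). Then u(s) / s is twice differentiable
    on the whole space, and Green's identity for it needs nothing but the
    fundamental theorem of calculus on lines and Fubini's theorem ([green_reg]).
    The chain rule gives
      Delta (u(s)/s) = u''/s (1 - e/s^2) + 3 e u'/s^4 - 3 e u/s^5,
    and 3 e / s^5 is an approximation of 4 pi delta: its integral is 4 pi for
    every e, by three explicit one-dimensional integrations ([mass_reg]). Once
    u0 g(0) 3 e / s^5 is subtracted, the integrand is bounded uniformly in e by a
    multiple of s^(-5/2) on a cube around the support of g, and by a multiple of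
    the mass kernel at e = 1 off the cube ([smoothed_bound]); so e may tend to 0
    by dominated convergence. The exponent 5/2 < 3 is integrable because
    s^(-5/2) is at most the product of the three |x_i|^(-5/6)
    ([majorant_integrable]).

    The complex statement follows by applying the real one to the real and
    imaginary parts of u and of the test function: both parts of u are
    Frobenius solutions of a coupled real system, and the products recombine
    into the operator applied to g times the kernel ([opA_kA]). The Hamiltonian
    needs no further work, as H g times k_H equals A g times k_A ([opH_kH]). *)

(** * Calculus on the real line *)

Section calculus.
Variable R : realType.
Implicit Types (f g F : R -> R) (x a b : R).
Local Notation leb := (@lebesgue_measure R).

(** Hidden from type class resolution, so that the rules below are applied in
    the order given by the expression and the derivative is computed by
    unification. *)
Definition has_deriv f x a : Prop := is_derive x 1 f a.

Lemma D_eq f x a b : has_deriv f x a -> a = b -> has_deriv f x b.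
Proof. by move=> df <-. Qed.

Lemma D_cst c x : has_deriv (fun=> c) x 0.
Proof. exact: is_derive_cst. Qed.

Lemma D_id x : has_deriv (fun t => t) x 1.
Proof. exact: is_derive_id. Qed.

Lemma D_add f g x a b : has_deriv f x a -> has_deriv g x b ->
  has_deriv (fun t => f t + g t) x (a + b).
Proof. by move=> ? ?; exact: is_deriveD. Qed.

Lemma D_opp f x a : has_deriv f x a -> has_deriv (fun t => - f t) x (- a).
Proof. by move=> ?; exact: is_deriveN. Qed.

Lemma D_mul f g x a b : has_deriv f x a -> has_deriv g x b ->
  has_deriv (fun t => f t * g t) x (a * g x + f x * b).
Proof.
rewrite /has_deriv => ? ?; apply: is_derive_eq (is_deriveM _ _) _.
by rewrite /GRing.scale /= addrC mulrC.
Qed.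

Lemma D_comp f g x a b : has_deriv f (g x) a -> has_deriv g x b ->
  has_deriv (fun t => f (g t)) x (a * b).
Proof.
rewrite /has_deriv => ? ?; apply: is_derive_eq (@is_derive1_comp _ f g x _ _ _ _) _.
by rewrite /GRing.scale/= mulrC.
Qed.

Lemma D_inv f x a : f x != 0 -> has_deriv f x a ->
  has_deriv (fun t => (f t)^-1) x (- a / f x ^+ 2).
Proof.
rewrite /has_deriv => fx ?; apply: is_derive_eq (is_deriveV _ _) _ => //.
by rewrite /GRing.scale /= mulNr mulrC mulNr.
Qed.

Lemma D_exp f n x a : has_deriv f x a ->
  has_deriv (fun t => f t ^+ n.+1) x (n.+1%:R * f x ^+ n * a).
Proof.
move=> df; elim: n => [|n IH]; first by rewrite expr0 !mul1r.
apply: (D_eq (D_mul df IH)).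
by rewrite [f x ^+ n.+1]exprS (natrD _ 1 n.+1); ring.
Qed.

Lemma D_sqrt f x a : 0 < f x -> has_deriv f x a ->
  has_deriv (fun t => Num.sqrt (f t)) x (a / (2 * Num.sqrt (f x))).
Proof.
move=> fx df; apply: D_eq; first exact: D_comp (is_derive1_sqrt fx) df.
by rewrite mulrC.
Qed.

Lemma D_ln f x a : 0 < f x -> has_deriv f x a ->
  has_deriv (fun t => ln (f t)) x (a / f x).
Proof.
move=> fx df; apply: D_eq; first exact: D_comp (is_derive1_ln fx) df.
by rewrite mulrC.
Qed.

Lemma D_powR f (p : R) x a : 0 < f x -> has_deriv f x a ->
  has_deriv (fun t => f t `^ p) x (p * f x `^ (p - 1) * a).
Proof.
by move=> fx df; apply: D_eq; first exact: (@D_comp (fun t => t `^ p) f) (is_derive1_powR p fx) df.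
Qed.

Lemma D_atan f x a : has_deriv f x a ->
  has_deriv (fun t => atan (f t)) x (a / (1 + f x ^+ 2)).
Proof.
move=> df; apply: D_eq; first exact: D_comp (is_derive1_atan (f x)) df.
by rewrite mulrC.
Qed.

Lemma D_continuous f x a : has_deriv f x a -> {for x, continuous f}.
Proof.
by move=> df; apply: differentiable_continuous; apply/derivable1_diffP; exact: (@ex_derive _ _ _ _ _ _ _ df).
Qed.

Lemma powR_continuous (p x : R) : 0 < x -> {for x, continuous (fun t => t `^ p)}.
Proof. by move=> x0; apply: D_continuous; apply: (@D_powR (fun t => t) p x 1 x0); exact: D_id. Qed.

(** The fundamental theorem of calculus on the half line, doubled by symmetry.
    The factor k is kept outside so that iterated integrals chain. *)
Lemma even_integral f F (l : R) : (forall x, 0 <= f x) -> continuous f ->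
  (forall x, f (- x) = f x) -> (forall x, has_deriv F x (f x)) -> F 0 = 0 ->
  F x @[x --> +oo%R] --> l ->
  forall k, 0 <= k -> (\int[leb]_x (k * f x)%:E = (k * (2 * l))%:E)%E.
Proof.
move=> f0 cf ef dF F0 Fl k k0; under eq_integral do rewrite EFinM.
rewrite ge0_integralZl_EFin //; last 2 first.
- by move=> x _; rewrite lee_fin.
- by apply/measurable_EFinP; exact: continuous_measurable_fun.
rewrite (@ge0_symfun_integralT _ f) //; last by move=> x; rewrite /= ef.
rewrite -set_itvcy (@ge0_continuous_FTC2y _ f F 0 l) ?F0 ?sube0 ?EFinM //.
- exact: continuous_subspaceT.
- by move=> x _; exact: (@ex_derive _ _ _ _ _ _ _ (dF x)).
- have := D_continuous (dF 0); rewrite /prop_for /continuous_at F0 => h.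
  exact: cvg_at_right_filter.
- by move=> x _; rewrite derive1E; apply: (@derive_val _ _ _ _ _ _ _ (dF x)).
Qed.

Lemma integral_has_deriv f F a b : a < b ->
  (forall x, a <= x <= b -> has_deriv F x (f x)) ->
  (forall x, a <= x <= b -> {for x, continuous f}) ->
  (\int[leb]_(x in `[a, b]) (f x)%:E = (F b - F a)%:E)%E.
Proof.
move=> ab dF cf; rewrite EFinB; apply: continuous_FTC2 => //.
- apply/continuous_within_itvP => //; split.
  + by move=> x /[!in_itv]/= /andP[ax xb]; apply: cf; rewrite !ltW.
  + by apply: cvg_at_right_filter; apply: cf; rewrite lexx ltW.
  + by apply: cvg_at_left_filter; apply: cf; rewrite lexx ltW.
- split.
  + move=> x /[!in_itv]/= /andP[ax xb].
    by apply: (@ex_derive _ _ _ _ _ _ _ (dF x _)); rewrite !ltW.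
  + by apply: cvg_at_right_filter; apply: (D_continuous (dF _ _)); rewrite lexx ltW.
  + by apply: cvg_at_left_filter; apply: (D_continuous (dF _ _)); rewrite lexx ltW.
- move=> x /[!in_itv]/= /andP[ax xb].
  by rewrite derive1E; apply: (@derive_val _ _ _ _ _ _ _ (dF x _)); rewrite !ltW.
Qed.

Lemma cvg_inv_pinfty (c : R) : c / x @[x --> +oo%R] --> (0 : R).
Proof.
apply/cvgr0Pnorm_lt => e e0; near=> x.
have x0 : 0 < x by near: x; exact: nbhs_pinfty_gt.
rewrite normrM normfV (gtr0_norm x0) ltr_pdivrMr // mulrC -ltr_pdivrMr //.
by near: x; apply: nbhs_pinfty_gt; exact: num_real.
Unshelve. all: by end_near. Qed.

Lemma atan_nondecreasing : {homo (@atan R) : x y / x <= y}.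
Proof.
move=> x y xy; apply: (@ger0_derive1_le_cc _ _ x y) => //.
- by move=> z _; rewrite derive1E derive_val invr_ge0 addr_ge0 ?sqr_ge0.
- by apply: continuous_subspaceT => z; exact: continuous_atan.
- by rewrite in_itv/= lexx.
- by rewrite in_itv/= lexx andbT.
Qed.

Lemma cvg_atan_pinfty : atan x @[x --> +oo%R] --> (pi / 2 : R).
Proof.
apply/cvgrPdist_le => e e0.
have pi0 := pi_gt0 R.
have [d [d0 de dpi]] : exists d : R, [/\ 0 < d, d <= e & d < pi].
  exists (Num.min e (pi / 2)); split.
  - by rewrite lt_min e0 divr_gt0.
  - by rewrite ge_min lexx.
  - by rewrite gt_min; apply/orP; right; lra.
near=> x; rewrite ger0_norm ?subr_ge0 ?(ltW (atan_ltpi2 _)) //.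
have : atan (tan (pi / 2 - d)) <= atan x.
  by apply: atan_nondecreasing; near: x; apply: nbhs_pinfty_ge; exact: num_real.
rewrite tanK; first lra.
by rewrite in_itv /=; apply/andP; split; lra.
Unshelve. all: by end_near. Qed.

Lemma cvg_quot_sqrt (c : R) : 0 < c ->
  x / Num.sqrt (c + x ^+ 2) @[x --> +oo%R] --> (1 : R).
Proof.
move=> c0; apply: (@squeeze_cvgr _ _ _ _ (fun x => 1 - c / x) (cst 1)).
- near=> x.
  have x1 : 1 <= x by near: x; apply: nbhs_pinfty_ge; exact: num_real.
  have x0 : 0 < x by apply: lt_le_trans x1.
  have s2 : Num.sqrt (c + x ^+ 2) ^+ 2 = c + x ^+ 2.
    by rewrite sqr_sqrtr // addr_ge0 ?sqr_ge0 ?ltW.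
  have s0 : 0 < Num.sqrt (c + x ^+ 2) by rewrite sqrtr_gt0 ltr_wpDr ?sqr_ge0.
  move: (Num.sqrt _) s2 s0 => s s2 s0.
  apply/andP; split; last by rewrite ler_pdivrMr // mul1r; nra.
  rewrite ler_pdivlMr // -(ler_pM2r x0) mulrAC mulrBl mul1r divfK ?gt_eqF //.
  have sxc : s <= x + c by nra.
  by have [xc|xc] := leP x c; nra.
- rewrite -[X in _ --> X]subr0; apply: cvgB; [exact: cvg_cst|exact: cvg_inv_pinfty].
- exact: cvg_cst.
Unshelve. all: by end_near. Qed.

End calculus.

(** Differentiates an explicit expression, leaving the nonvanishing of the
    denominators and the positivity of the radicands. *)
Ltac derive_auto := repeat first [exact: D_cst | exact: D_id | apply: D_add
  | apply: D_opp | apply: D_mul | apply: D_exp | apply: D_inv | apply: D_sqrt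
  | apply: D_ln | apply: D_powR | apply: D_atan].

(** * Lebesgue measure on the three-dimensional space *)

Section lebesgue2.
Variable R : realType.
Local Notation MR := (measurableTypeR R).

Definition leb1 : {sigma_finite_measure set MR -> \bar R} := @lebesgue_measure R.
Definition leb2 : set (MR * MR)%type -> \bar R := (leb1 \x leb1)%E.
HB.instance Definition _ := Measure.on leb2.

Lemma itv_lty (a b : R) : (leb1 `[a, b]%classic < +oo)%E.
Proof.
by rewrite /leb1 /= lebesgue_measure_itv /=; case: ifP => _; rewrite -?EFinB ltry.
Qed.

Lemma leb2_sigma_finite : sigma_finite setT leb2.
Proof.
exists (fun n : nat => `[- n%:R, n%:R]%classic `*` `[- n%:R, n%:R]%classic).
  apply/seteqP; split=> // -[x y] _.
  exists (Num.truncn (`|x| + `|y|)).+1 => //=.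
  have h : `|x| + `|y| <= (Num.truncn (`|x| + `|y|)).+1%:R by rewrite ltW // truncnS_gt.
  by split; rewrite /= in_itv /= -ler_norml (le_trans _ h) // ?lerDl ?lerDr.
move=> n; split; first by apply: measurableX; exact: measurable_itv.
rewrite [X in (X < _)%E](_ : _ = leb1 `[(- n%:R)%R, n%:R]%classic * leb1 `[(- n%:R)%R, n%:R]%classic)%E; last first.
  by apply: product_measure1E; exact: measurable_itv.
by rewrite lte_mul_pinfty ?itv_lty // ge0_fin_numE ?itv_lty.
Qed.

HB.instance Definition _ := Measure_isSigmaFinite.Build _ _ _ leb2 leb2_sigma_finite.

(** The plane is packed with its sigma-finite structure because it is the first
    factor of the product measure on the space, in which Fubini's theorem is
    applied. *)
Definition leb2S : {sigma_finite_measure set (MR * MR)%type -> \bar R} := leb2.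
End lebesgue2.

Section measure3.
Variable R : realType.
Local Notation E3 := (R * R * R)%type.
Local Notation MR := (measurableTypeR R).
Local Notation M3 := (measurableTypeR R * measurableTypeR R * measurableTypeR R)%type.
Local Notation leb := (@lebesgue_measure R).
Local Notation leb3 := (@leb3 R).

(** The measurable sets of the product are generated by rectangles and not by
    the topology; an open set is a countable union of rational boxes. *)
Lemma open3_measurable (U : set E3) : open U -> measurable (U : set M3).
Proof.
move=> oU.
pose box (q : rat * rat * rat * nat) : set M3 :=
  ([set t : R | `|ratr q.1.1.1 - t| < q.2.+1%:R^-1]
   `*` [set t : R | `|ratr q.1.1.2 - t| < q.2.+1%:R^-1])
   `*` [set t : R | `|ratr q.1.2 - t| < q.2.+1%:R^-1].
have mbox q : measurable (box q).
  have mi (c e : R) : measurable ([set t : R | `|c - t| < e] : set MR).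
    rewrite (_ : [set t | _] = `]c - e, c + e[%classic); first exact: measurable_itv.
    by apply/seteqP; split=> t /=; rewrite in_itv /= ltr_distlC.
  by apply: measurableX => //; apply: measurableX.
have -> : U = \bigcup_(q in [set q | box q `<=` U]) box q.
  apply/seteqP; split=> [[[x y] z] Ux|x [q /= qU /qU]//].
  have /nbhs_ballP[e /= e0 eU] : nbhs (x, y, z) U by exact: open_nbhs_nbhs.
  have [k] := ltr_add_invr (divr_gt0 e0 (ltr0n R 2)).
  rewrite add0r => ke.
  have rq (t : R) : exists q : rat, `|ratr q - t| < k.+1%:R^-1.
    have [|q] := @rat_in_itvoo R (t - k.+1%:R^-1) (t + k.+1%:R^-1).
      by rewrite ltrD2l gtrN.
    by move=> /itvP h; exists q; rewrite ltr_distl !h.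
  have [[a ha] [[b hb] [c hc]]] := (rq x, (rq y, rq z)).
  exists (a, b, c, k) => //=.
  move=> [[x' y'] z'] [[/= h1 h2] h3]; apply: eU.
  have tri (q t t' : R) : `|q - t| < k.+1%:R^-1 -> `|q - t'| < k.+1%:R^-1 -> `|t - t'| < e.
    move: ke; move: (k.+1%:R^-1) => d ke; rewrite !ltr_distl => /andP[? ?] /andP[? ?]; apply/andP; split; lra.
  by split; [split|]; rewrite /ball /=; apply: tri; eassumption.
rewrite bigcup_mkcond; apply: countable_bigcupT_measurable => // q.
by case: ifP.
Qed.

Lemma continuous3_measurable (f : E3 -> R) :
  continuous f -> measurable_fun setT (f : M3 -> R).
Proof.
move=> /continuousP cf; apply: (measurability _ (RGenOpens.measurableE R)).
move=> _ [_ [a [b ->] <-]]; rewrite setTI; apply: open3_measurable.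
exact/cf/interval_open.
Qed.

Lemma compact3_measurable (K : set E3) : compact K -> measurable (K : set M3).
Proof.
move=> /compact_closed - /(_ (@norm_hausdorff _ _)) /closed_openC /open3_measurable.
by move=> /measurableC; rewrite setCK.
Qed.

Lemma bounded_support_integrable d (T : measurableType d)
    (mu : {measure set T -> \bar R}) (f : T -> R) (A : set T) (C : R) :
  measurable A -> (mu A < +oo)%E -> measurable_fun setT f ->
  (forall x, ~ A x -> f x = 0) -> (forall x, `|f x| <= C) ->
  mu.-integrable setT (EFin \o f).
Proof.
move=> mA muA mf f0 fC.
have -> : EFin \o f = (EFin \o f) \_ A.
  apply/funext => x; rewrite patchE; case: ifPn => // /negP.
  by rewrite inE => Ax /=; rewrite f0.
apply/(integrable_mkcond _ mA); apply: measurable_bounded_integrable => //.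
  exact: measurable_funTS.
by exists C; split; [exact: num_real|move=> y Cy x _; exact: le_trans (fC x) (ltW Cy)].
Qed.

Section cube.
Variable M : R.
Definition cube : set M3 := (`[- M, M] `*` `[- M, M]) `*` `[- M, M].

Lemma cubeP (x : E3) : cube x <-> `|x| <= M.
Proof.
rewrite !prod_normE /= !ge_max; split.
  by move=> [[]]; rewrite /= !in_itv /= -!ler_norml => -> -> ->.
move=> /andP[/andP[]]; rewrite !ler_norml => ? ? ?.
by do 2?split => //=; rewrite in_itv.
Qed.

Lemma cube_measurable : measurable cube.
Proof. by apply: measurableX; [apply: measurableX|]; exact: measurable_itv. Qed.

Lemma square_lty :
  (leb2S R (`[(- M)%R, M]%classic `*` `[(- M)%R, M]%classic) < +oo)%E.
Proof.
have mI : measurable (`[- M, M]%classic : set MR) by exact: measurable_itv.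
have e2 : (leb2S R _ = _)%E := @product_measure1E _ _ _ _ _ (leb1 R) (leb1 R) _ _ mI mI.
by rewrite e2 lte_mul_pinfty ?itv_lty // ge0_fin_numE ?itv_lty.
Qed.

Lemma cube_lty : (leb3 cube < +oo)%E.
Proof.
have mI : measurable (`[- M, M]%classic : set MR) by exact: measurable_itv.
have e3 : (leb3 cube = _)%E :=
  @product_measure1E _ _ _ _ _ (leb2S R) (leb1 R) _ _ (measurableX mI mI) mI.
by rewrite e3 lte_mul_pinfty ?itv_lty // ge0_fin_numE ?square_lty.
Qed.
End cube.

Lemma continuous_bounded_cube (f : E3 -> R) (M : R) : continuous f ->
  exists C, forall x, cube M x -> `|f x| <= C.
Proof.
move=> cf.
have cI : compact (`[- M, M]%classic : set R) by exact: segment_compact.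
have cc : compact (cube M : set E3) by exact: compact_setX (compact_setX cI cI) cI.
have /compact_bounded[C [_ hC]] : compact (f @` (cube M)).
  by apply: continuous_compact => //; exact: continuous_subspaceT.
by exists (C + 1) => x cx; apply: hC; [rewrite ltrDl|exists x].
Qed.

Lemma continuous_support_integrable (f : E3 -> R) (M : R) : continuous f ->
  (forall x, ~ cube M x -> f x = 0) -> leb3.-integrable setT (EFin \o f : M3 -> \bar R).
Proof.
move=> cf f0; have [C fC] := continuous_bounded_cube M cf.
apply: (@bounded_support_integrable _ _ leb3 f (cube M) `|C|) => //.
- exact: cube_measurable.
- exact: cube_lty.
- exact: continuous3_measurable.
- move=> x; have [cx|cx] := pselect (cube M x); last by rewrite f0 // normr0.
  exact: le_trans (fC _ cx) (ler_norm _).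
Qed.

(** * The mass of the regularised kernel *)

(** With q = z / sqrt (c + z^2), an antiderivative is (q - q^3 / 3) / c^2. *)
Lemma integral_inv_sqrt5 (c k : R) : 0 < c -> 0 <= k ->
  (\int[leb]_z (k / Num.sqrt (c + z ^+ 2) ^+ 5)%:E = (k * (4 / 3 / c ^+ 2))%:E)%E.
Proof.
move=> c0 k0.
have s0 (z : R) : 0 < c + z ^+ 2 by rewrite ltr_wpDr ?sqr_ge0.
pose q (z : R) := z / Num.sqrt (c + z ^+ 2).
have sq (z : R) : 0 < Num.sqrt (c + z ^+ 2) by rewrite sqrtr_gt0.
have sq2 (z : R) : Num.sqrt (c + z ^+ 2) ^+ 2 = c + z ^+ 2 by rewrite sqr_sqrtr // ltW.
apply: etrans; first apply: (@even_integral _ _ (fun z => (q z - q z ^+ 3 / 3) / c ^+ 2)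
  ((1 - 1 ^+ 3 / 3) / c ^+ 2) _ _ _ _ _ _ _ k0).
- by move=> z; rewrite invr_ge0 exprn_ge0 ?sqrtr_ge0.
- move=> z; apply: (@D_continuous).
  by derive_auto; rewrite // gt_eqF ?exprn_gt0.
- by move=> z; rewrite sqrrN.
- move=> z; apply: D_eq; rewrite /q.
    by derive_auto; rewrite // gt_eqF ?exprn_gt0.
  rewrite /=.
  move: (sq z) (sq2 z); move: (Num.sqrt _) => s s1 s2.
  have cE : c = s ^+ 2 - z ^+ 2 by rewrite s2 addrK.
  by rewrite cE; field; rewrite -cE !gt_eqF.
- by rewrite /q !mul0r expr0n /= !mul0r subrr mul0r.
- apply: cvgM; last exact: cvg_cst.
  have cq := cvg_quot_sqrt c0.
  apply: cvgB => //; apply: cvgM; last exact: cvg_cst.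
  by apply: (@cvg_comp _ _ _ q (fun t => t ^+ 3) _ _ _ cq); exact: exprn_continuous.
by congr EFin; congr (k * _); field; rewrite gt_eqF.
Qed.

(** An antiderivative is z / (c sqrt (c + z^2)). *)
Lemma integral_inv_sqrt3 (c k : R) : 0 < c -> 0 <= k ->
  (\int[leb]_z (k / Num.sqrt (c + z ^+ 2) ^+ 3)%:E = (k * (2 / c))%:E)%E.
Proof.
move=> c0 k0.
have s0 (z : R) : 0 < c + z ^+ 2 by rewrite ltr_wpDr ?sqr_ge0.
have sq (z : R) : 0 < Num.sqrt (c + z ^+ 2) by rewrite sqrtr_gt0.
have sq2 (z : R) : Num.sqrt (c + z ^+ 2) ^+ 2 = c + z ^+ 2 by rewrite sqr_sqrtr // ltW.
apply: etrans; first apply: (@even_integral _ _ (fun z => z / Num.sqrt (c + z ^+ 2) / c)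
  (1 / c) _ _ _ _ _ _ _ k0).
- by move=> z; rewrite invr_ge0 exprn_ge0 ?sqrtr_ge0.
- move=> z; apply: (@D_continuous).
  by derive_auto; rewrite // gt_eqF ?exprn_gt0.
- by move=> z; rewrite sqrrN.
- move=> z; apply: D_eq.
    by derive_auto; rewrite // gt_eqF ?exprn_gt0.
  rewrite /=.
  move: (sq z) (sq2 z); move: (Num.sqrt _) => s s1 s2.
  have cE : c = s ^+ 2 - z ^+ 2 by rewrite s2 addrK.
  by rewrite cE; field; rewrite -cE !gt_eqF.
- by rewrite !mul0r.
- apply: cvgM; [exact: cvg_quot_sqrt|exact: cvg_cst].
by congr EFin; congr (k * _); rewrite mulrA mulr1.
Qed.

(** With b = sqrt c, an antiderivative is
    (atan (y / b) + y b / (c + y^2)) / (2 b^3). *)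
Lemma integral_inv_sqr (c k : R) : 0 < c -> 0 <= k ->
  (\int[leb]_y (k / (c + y ^+ 2) ^+ 2)%:E = (k * (pi / 2 / Num.sqrt c ^+ 3))%:E)%E.
Proof.
move=> c0 k0.
have s0 (z : R) : 0 < c + z ^+ 2 by rewrite ltr_wpDr ?sqr_ge0.
pose b := Num.sqrt c.
have b0 : 0 < b by rewrite sqrtr_gt0.
have cb : c = b ^+ 2 by rewrite sqr_sqrtr // ltW.
apply: etrans; first apply: (@even_integral _ _ (fun y => (atan (y / b) + y * b / (c + y ^+ 2)) / (2 * b ^+ 3))
  ((pi / 2 + 0) / (2 * b ^+ 3)) _ _ _ _ _ _ _ k0).
- by move=> z; rewrite invr_ge0 sqr_ge0.
- move=> z; apply: (@D_continuous).
  by derive_auto; rewrite // gt_eqF ?exprn_gt0.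
- by move=> z; rewrite sqrrN.
- move=> y; apply: D_eq.
    by derive_auto; rewrite // gt_eqF ?exprn_gt0.
  rewrite /= cb; field.
  by rewrite (gt_eqF b0) -cb gt_eqF.
- by rewrite !mul0r atan0 addr0 mul0r.
- apply: cvgM; last exact: cvg_cst.
  apply: cvgD.
    apply: (@cvg_comp _ _ _ (fun y => y / b) (@atan R) _ +oo%R); last exact: cvg_atan_pinfty.
    apply: gt0_cvgMly; [by rewrite invr_gt0|exact: cvg_id].
  apply: (@squeeze_cvgr _ _ _ _ (cst 0) (fun y => b / y)).
  + near=> y.
    have y0 : 0 < y by near: y; apply: nbhs_pinfty_gt; exact: num_real.
    apply/andP; split; first by rewrite divr_ge0 ?mulr_ge0 ?ltW.
    rewrite ler_pdivrMr // mulrAC ler_pdivlMr //; nra.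
  + exact: cvg_cst.
  + exact: cvg_inv_pinfty.
congr EFin; congr (k * _); rewrite -/b; field.
by rewrite gt_eqF.
Unshelve. all: by end_near. Qed.

Section regularised_radius.
Variable e : R.
Hypothesis e0 : 0 < e.

(** The radius, smoothed so that functions of it are as regular at the origin as
    elsewhere. *)
Definition reg (x : E3) : R :=
  Num.sqrt (e + (x.1.1 ^+ 2 + x.1.2 ^+ 2 + x.2 ^+ 2)).

Lemma sqnorm_ge0 (x : E3) : 0 <= x.1.1 ^+ 2 + x.1.2 ^+ 2 + x.2 ^+ 2.
Proof. by rewrite !addr_ge0 ?sqr_ge0. Qed.

Lemma reg_gt0 x : 0 < reg x.
Proof. by rewrite sqrtr_gt0 ltr_wpDr // sqnorm_ge0. Qed.
End regularised_radius.

Lemma continuous_sqnorm : continuous (fun x : E3 => x.1.1 ^+ 2 + x.1.2 ^+ 2 + x.2 ^+ 2).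
Proof.
move=> [[a b] c].
have c2 : (fun x : E3 => x.2) x @[x --> (a, b, c)] --> c by exact: cvg_snd.
have c1 : (fun x : E3 => x.1) x @[x --> (a, b, c)] --> (a, b) by exact: cvg_fst.
have c11 : (fun x : E3 => x.1.1) x @[x --> (a, b, c)] --> a by apply: (@cvg_comp _ _ _ (fun x : E3 => x.1) (fun y => y.1) _ _ _ c1); exact: cvg_fst.
have c12 : (fun x : E3 => x.1.2) x @[x --> (a, b, c)] --> b by apply: (@cvg_comp _ _ _ (fun x : E3 => x.1) (fun y => y.2) _ _ _ c1); exact: cvg_snd.
have sq (f : E3 -> R) (l : R) : f x @[x --> (a, b, c)] --> l -> f x ^+ 2 @[x --> (a, b, c)] --> l ^+ 2.
  by move=> cf; apply: (@cvg_comp _ _ _ f (fun t => t ^+ 2) _ _ _ cf); exact: exprn_continuous.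
by apply: cvgD; [apply: cvgD|]; apply: sq.
Qed.

Lemma continuous_reg e : continuous (reg e).
Proof.
move=> x; apply: (@continuous_comp _ _ _ (fun x : E3 => e + (x.1.1 ^+ 2 + x.1.2 ^+ 2 + x.2 ^+ 2)) Num.sqrt); last exact: sqrt_continuous.
by apply: cvgD; [exact: cvg_cst|exact: continuous_sqnorm].
Qed.

Lemma tonelli3 (f : M3 -> \bar R) : measurable_fun setT f ->
  (forall x, 0 <= f x)%E ->
  (\int[leb3]_x f x = \int[leb]_x \int[leb]_y \int[leb]_z f (x, y, z))%E.
Proof.
move=> mf f0.
transitivity (\int[leb2S R]_p fubini_F (leb1 R) f p)%E.
  exact: (@fubini_tonelli1 _ _ _ _ _ (leb2S R) (leb1 R) f mf f0).
have mF := @measurable_fun_fubini_tonelli_F _ _ _ _ _ (leb1 R) f mf f0.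
have F0 x : (0 <= fubini_F (leb1 R) f x)%E by apply: integral_ge0.
exact: (@fubini_tonelli1 _ _ _ _ _ (leb1 R) (leb1 R) _ mF F0).
Qed.

(** Integrating 3 e / s^5 in z, y and x in turn gives 4 e / (e + x^2 + y^2)^2,
    then 2 pi e / (e + x^2)^(3/2), then 4 pi. *)
Lemma mass_reg (e : R) : 0 < e ->
  (\int[leb3]_x (3 * e / reg e x ^+ 5)%:E = (4 * pi)%:E)%E.
Proof.
move=> e0; rewrite tonelli3; last 2 first.
- apply/measurable_EFinP; apply: continuous3_measurable => x.
  apply: cvgM; first exact: cvg_cst.
  apply: cvgV; first by rewrite gt_eqF // exprn_gt0 // reg_gt0.
  apply: (@continuous_comp _ _ _ (reg e) (fun t => t ^+ 5)); first exact: continuous_reg.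
  exact: exprn_continuous.
- by move=> x; rewrite lee_fin divr_ge0 ?exprn_ge0 ?mulr_ge0 ?(ltW (reg_gt0 _ _)) // ltW.
have sq_pos (c t : R) : 0 < c -> 0 < c + t ^+ 2 by move=> c0; rewrite ltr_wpDr ?sqr_ge0.
transitivity (\int[leb]_x (4 * e * (pi / 2) / Num.sqrt (e + x ^+ 2) ^+ 3)%:E)%E.
  apply: eq_integral => x _.
  transitivity (\int[leb]_y (4 * e / (e + x ^+ 2 + y ^+ 2) ^+ 2)%:E)%E; last first.
    by rewrite integral_inv_sqr ?sq_pos ?mulr_ge0 ?(ltW e0) // mulrA.
  apply: eq_integral => y _; rewrite /reg /=.
  under eq_integral do rewrite !addrA.
  rewrite integral_inv_sqrt5 ?mulr_ge0 ?sq_pos ?(ltW e0) //.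
  by congr EFin; field; rewrite gt_eqF // !sq_pos.
rewrite integral_inv_sqrt3 //; last by rewrite !mulr_ge0 ?invr_ge0 ?pi_ge0 // ltW.
by congr EFin; field; rewrite gt_eqF.
Qed.

(** * An integrable majorant *)

Section singular.

(** Regularisations of |t|^(-5/6). Their limit [sing] is +oo at 0, whereas the
    power itself is 0 there; so the lower bound [majorant_ge] also holds on
    the coordinate planes. *)
Definition sing_approx (n : nat) (t : R) : R := (`|t| + n.+1%:R^-1) `^ (- (5 / 6)).

Definition sing (t : MR) : \bar R := limn (fun n => (sing_approx n t)%:E).

Lemma sing_approx_ge0 n t : 0 <= sing_approx n t.
Proof. exact: powR_ge0. Qed.

Lemma powR_anti (p x y : R) : 0 <= p -> 0 < x -> x <= y -> y `^ (- p) <= x `^ (- p).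
Proof.
move=> p0 x0 xy; have y0 := lt_le_trans x0 xy.
rewrite !powRN lef_pV2 ?posrE ?powR_gt0 //.
by apply: ge0_ler_powR => //; rewrite nnegrE ltW.
Qed.

Lemma sing_approx_nd t : nondecreasing_seq (fun n => (sing_approx n t)%:E).
Proof.
move=> n m nm; rewrite lee_fin; apply: powR_anti => //.
by rewrite lerD2l lef_pV2 ?posrE // ler_nat ltnS.
Qed.

Lemma sing_approx_measurable n : measurable_fun setT (fun t : MR => (sing_approx n t)%:E).
Proof.
apply/measurable_EFinP; apply: continuous_measurable_fun => t.
have t0 : 0 < `|t| + n.+1%:R^-1 by rewrite ltr_wpDl // invr_gt0.
apply: (@continuous_comp _ _ _ (fun t : R => `|t| + n.+1%:R^-1) (fun s => s `^ (- (5 / 6)))).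
  by apply: cvgD; [exact: norm_continuous|exact: cvg_cst].
exact: powR_continuous.
Qed.

Lemma sing_measurable : measurable_fun setT sing.
Proof.
apply: (@emeasurable_fun_cvg _ _ _ _ (fun n t => (sing_approx n t)%:E)).
  exact: sing_approx_measurable.
by move=> t _; apply: ereal_nondecreasing_is_cvgn; exact: sing_approx_nd.
Qed.

Lemma sing_ge (s t : R) : 0 < s -> `|t| <= s -> ((s `^ (- (5 / 6)))%:E <= sing t)%E.
Proof.
move=> s0 ts.
have cs : (fun n => ((s + n.+1%:R^-1) `^ (- (5 / 6)))%:E) @ \oo --> (s `^ (- (5 / 6)))%:E.
  apply: cvg_EFin; first by near=> n.
  apply: (@cvg_comp _ _ _ (fun n => s + n.+1%:R^-1) (fun x => x `^ (- (5 / 6))) _ (nbhs s)).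
    by have := cvgD (cvg_cst s) (@cvg_harmonic R); rewrite addr0; apply.
  exact: powR_continuous.
rewrite -(cvg_lim _ cs) //; apply: lee_lim.
- by apply/cvg_ex; eexists; exact: cs.
- by apply: ereal_nondecreasing_is_cvgn; exact: sing_approx_nd.
- near=> n; rewrite lee_fin; apply: powR_anti; first by rewrite divr_ge0.
    by rewrite ltr_wpDl // invr_gt0.
  by rewrite lerD2r.
Unshelve. all: by end_near. Qed.

Lemma sing_ge0 t : (0 <= sing t)%E.
Proof.
by apply: le_trans (sing_ge (s := `|t| + 1) _ _); rewrite ?lee_fin ?powR_ge0 ?ltr_wpDl ?lerDl.
Qed.

(** 5/6 < 1: the regularisations have the antiderivative 6 (|t| + d)^(1/6), up to a
    sign, which bounds the integrals uniformly. *)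
Lemma sing_lty (M : R) : 0 < M -> (\int[leb]_(t in `[(- M)%R, M]) sing t < +oo)%E.
Proof.
move=> M0.
pose B : R := 12 * (M + 1) `^ (1 / 6).
apply: (@le_lt_trans _ _ B%:E); last by rewrite ltry.
rewrite /sing monotone_convergence //; last 3 first.
- by move=> n; apply: measurable_funTS; exact: sing_approx_measurable.
- by move=> n x _; rewrite lee_fin sing_approx_ge0.
- by move=> x _; exact: sing_approx_nd.
apply: lime_le.
  apply: ereal_nondecreasing_is_cvgn => n m nm; apply: ge0_le_integral => //.
  - by move=> x _; rewrite lee_fin sing_approx_ge0.
  - by apply: measurable_funTS; exact: sing_approx_measurable.
  - by apply: measurable_funTS; exact: sing_approx_measurable.
  - by move=> x _; exact: sing_approx_nd.
apply: nearW => n.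
set d : R := n.+1%:R^-1; have d0 : 0 < d by rewrite invr_gt0.
have d1 : d <= 1 by rewrite invf_le1 // ler1n.
(* The two halves of the interval, sg being the sign of t on each. *)
have half (sg : R) (a b : R) : sg ^+ 2 = 1 -> a < b -> (forall x, a <= x <= b -> sg * x = `|x|) ->
  (\int[leb]_(t in `[a, b]%classic) (sing_approx n t)%:E =
   (6 * sg * (`|b| + d) `^ (1 / 6) - 6 * sg * (`|a| + d) `^ (1 / 6))%:E)%E.
  move=> sg2 ab sgE.
  have pos x : a <= x <= b -> 0 < sg * x + d by move=> /sgE ->; rewrite ltr_wpDl.
  transitivity (\int[leb]_(t in `[a, b]) ((sg * t + d) `^ (- (5 / 6)))%:E)%E.
    by apply: eq_integral => x /[!inE] /= /[!in_itv]/= xab; rewrite /sing_approx -/d -(sgE x).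
  pose F x := 6 * sg * (sg * x + d) `^ (1 / 6).
  have dF x : a <= x <= b -> has_deriv F x ((sg * x + d) `^ (- (5 / 6))).
    move=> /pos x0; apply: D_eq; first by derive_auto.
    have -> : 1 / 6 - 1 = - (5 / 6) :> R by field.
    rewrite -[RHS]mul1r; transitivity (sg ^+ 2 * (sg * x + d) `^ (- (5 / 6))); last by rewrite sg2.
    by field.
  have cf x : a <= x <= b -> {for x, continuous (fun x => (sg * x + d) `^ (- (5 / 6)))}.
    move=> /pos x0.
    apply: (D_continuous (a := - (5 / 6) * (sg * x + d) `^ (- (5 / 6) - 1) * (0 * x + sg * 1 + 0))).
    by derive_auto.
  rewrite (integral_has_deriv ab dF cf) /F.
  by rewrite !sgE ?lexx ?ltW.
rewrite (@itv_bndbnd_setU _ _ (BLeft (- M)) (BRight 0) (BRight M)) ?bnd_simp; [|lra|lra].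
rewrite ge0_integral_setU //=; last 3 first.
- by apply: measurable_funTS; exact: sing_approx_measurable.
- by move=> x _; rewrite lee_fin sing_approx_ge0.
- by apply: lt_disjoint => x y; rewrite !in_itv/= => /andP[_ x0] /andP[y0 _]; exact: le_lt_trans x0 y0.
rewrite integral_itv_obnd_cbnd; last first.
  by apply: measurable_funTS; exact: sing_approx_measurable.
have hl := half (-1) (- M) 0 _ _ _; have hr := half 1 0 M _ _ _.
rewrite hl ?hr //; first last.
- by move=> x /andP[_ x0]; rewrite mulN1r ler0_norm.
- by rewrite oppr_lt0.
- by rewrite sqrrN expr1n.
- by move=> x /andP[x0 _]; rewrite mul1r ger0_norm.
- by rewrite expr1n.
rewrite normrN normr0 (gtr0_norm M0) add0r -EFinD lee_fin /B.
have h1 : (M + d) `^ (1 / 6) <= (M + 1) `^ (1 / 6).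
  by apply: ge0_ler_powR; rewrite ?nnegrE ?lerD2l ?addr_ge0 ?divr_ge0 // ltW.
by have := powR_ge0 d (1 / 6); lra.
Qed.

Variable M : R.
Hypothesis M0 : 0 < M.

Definition majorant (x : M3) : \bar R :=
  ((sing \_ `[(- M)%R, M]) x.1.1 * (sing \_ `[(- M)%R, M]) x.1.2 * (sing \_ `[(- M)%R, M]) x.2)%E.

Lemma majorant_ge0 x : (0 <= majorant x)%E.
Proof. by rewrite !mule_ge0 // erestrict_ge0 // => t _; exact: sing_ge0. Qed.

(** The integral is the cube of a finite one-dimensional integral. *)
Lemma majorant_integrable : leb3.-integrable setT majorant.
Proof.
set h := sing \_ `[(- M)%R, M].
have h0 t : (0 <= h t)%E by apply: erestrict_ge0 => ? _; exact: sing_ge0.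
have mh : measurable_fun setT h.
  by apply/(measurable_restrictT _ _).1 => //; exact: measurable_funTS sing_measurable.
have Jlty : (\int[leb]_t h t < +oo)%E by rewrite -integral_mkcond; exact: sing_lty.
have J0 : (0 <= \int[leb]_t h t)%E by exact: integral_ge0.
have mm : measurable_fun setT majorant.
  apply: emeasurable_funM; [apply: emeasurable_funM|].
  - exact: (measurableT_comp mh (measurableT_comp measurable_fst measurable_fst)).
  - exact: (measurableT_comp mh (measurableT_comp measurable_snd measurable_fst)).
  - exact: (measurableT_comp mh measurable_snd).
apply/integrableP; split => //.
under eq_integral do rewrite gee0_abs ?majorant_ge0 //.
rewrite tonelli3 //; last exact: majorant_ge0.
under eq_integral => x _.
  under eq_integral => y _.
    rewrite /majorant /= ge0_integralZl //; last by rewrite mule_ge0.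
    over.
  rewrite ge0_integralZr //; last 2 first.
  - by apply: emeasurable_funM => //; exact: measurable_cst.
  - by move=> y _; rewrite mule_ge0.
  rewrite ge0_integralZl //.
  over.
rewrite ge0_integralZr //; last 2 first.
- by apply: emeasurable_funM => //; exact: measurable_cst.
- by move=> y _; rewrite mule_ge0.
rewrite ge0_integralZr //.
by rewrite !lte_mul_pinfty ?mule_ge0 // ge0_fin_numE ?mule_ge0 ?lte_mul_pinfty // ge0_fin_numE.
Qed.

(** s^(-5/2) is the product of three factors s^(-5/6), each at most
    |x_i|^(-5/6). *)
Lemma majorant_ge (x : M3) (s : R) : cube M x -> 0 < s ->
  `|x.1.1| <= s -> `|x.1.2| <= s -> `|x.2| <= s ->
  (((s ^+ 2 * Num.sqrt s)^-1)%:E <= majorant x)%E.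
Proof.
move=> [[c1 c2] c3] s0 h1 h2 h3.
have e3 : s `^ (- (5 / 6)) * s `^ (- (5 / 6)) * s `^ (- (5 / 6)) = (s ^+ 2 * Num.sqrt s)^-1.
  have sn : s != 0 by rewrite gt_eqF.
  rewrite -!powRD ?sn ?implybT //.
  have -> : - (5 / 6) + - (5 / 6) + - (5 / 6) = - (2 + 2^-1) :> R by field.
  rewrite powRN powRD; last by rewrite sn implybT.
  by rewrite powR_mulrn ?powR12_sqrt ?(ltW s0).
rewrite -e3 !EFinM.
rewrite /majorant !patchE !mem_set //.
by rewrite !lee_pmul ?mule_ge0 ?lee_fin ?powR_ge0 ?sing_ge.
Qed.
End singular.

End measure3.

(** * Green's identity for a regularised radius *)

Section green.
Variable R : realType.
Local Notation E3 := (R * R * R)%type.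
Local Notation MR := (measurableTypeR R).
Local Notation M3 := (measurableTypeR R * measurableTypeR R * measurableTypeR R)%type.
Local Notation leb := (@lebesgue_measure R).
Local Notation leb3 := (@leb3 R).
Implicit Types (f g F : E3 -> R) (x : E3) (i : 'I_3).

Definition coord i x : R :=
  match val i with 0 => x.1.1 | 1 => x.1.2 | _ => x.2 end.

Definition set_coord i x (t : R) : E3 :=
  match val i with 0 => (t, x.1.2, x.2) | 1 => (x.1.1, t, x.2) | _ => (x.1, t) end.

Lemma coord_set i x t : coord i (set_coord i x t) = t.
Proof. by rewrite /coord /set_coord; case: (val i) => [|[|]]. Qed.

Lemma set_coordK i x : set_coord i x (coord i x) = x.
Proof. by rewrite /coord /set_coord; case: x => [[? ?] ?]; case: (val i) => [|[|]]. Qed.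

Lemma set_coord_shift i x t (h : R) :
  h *: basis3 R i + set_coord i x t = set_coord i x (h + t).
Proof.
case: x => [[a b] c]; rewrite /basis3 /set_coord; case: (val i) => [|[|n]] /=;
  by congr (_, _, _); rewrite /= /GRing.scale /= ?mulr1 ?mulr0 ?add0r.
Qed.

Lemma coord_le_norm i x : `|coord i x| <= `|x|.
Proof.
rewrite !prod_normE /coord; case: (val i) => [|[|n]] /=;
  by rewrite !le_max lexx ?orbT.
Qed.

(** A partial derivative is the derivative along the line through the point
    parallel to the axis. *)
Lemma has_deriv_line f i x t : derivable f (set_coord i x t) (basis3 R i) ->
  has_deriv (fun t => f (set_coord i x t)) t ('D_(basis3 R i) f (set_coord i x t)).
Proof.
have E : (fun h => h^-1 *: ((f \o shift (set_coord i x t)) (h *: basis3 R i) - f (set_coord i x t)))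
  = (fun h => h^-1 *: (((fun t => f (set_coord i x t)) \o shift t) (h *: 1) - f (set_coord i x t))).
  by apply/funext => h; rewrite /= set_coord_shift /GRing.scale /= mulr1.
by move=> df; apply: DeriveDef; rewrite /derivable /derive -E.
Qed.

Lemma partials_vanish f (M : R) : (forall x, M < `|x| -> f x = 0) ->
  forall s x, M < `|x| -> partials s f x = 0.
Proof.
move=> f0; elim=> [|i s IH] x Mx //=; first exact: f0.
rewrite (@near_eq_derive _ _ _ _ (cst 0)) ?derive_cst //.
have : \forall y \near x, M < `|y| by have /cvgr_gt := @norm_continuous _ _ x; apply.
by apply: filterS => y /IH.
Qed.

Lemma not_cube M x : ~ cube M x -> M < `|x|.
Proof. by move=> cx; rewrite ltNge; apply/negP => /cubeP. Qed.

Lemma section_integrable F (M z : R) : continuous F ->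
  (forall x, ~ cube M x -> F x = 0) ->
  (leb2S R).-integrable setT (EFin \o (fun p : MR * MR => F (p, z))).
Proof.
move=> cF F0; have [C FC] := continuous_bounded_cube M cF.
apply: (@bounded_support_integrable _ _ _ (leb2S R) (fun p : MR * MR => F (p, z))
  (`[(- M)%R, M]%classic `*` `[(- M)%R, M]%classic) `|C|).
- by apply: measurableX; exact: measurable_itv.
- exact: square_lty.
- by apply: (measurableT_comp (continuous3_measurable cF)); apply: measurable_fun_pair.
- by move=> p cp; apply: F0; case.
- move=> p; have [cx|cx] := pselect (cube M (p, z)); last by rewrite F0 // normr0.
  exact: le_trans (FC _ cx) (ler_norm _).
Qed.

(** By Fubini's theorem the direction i may be integrated first. *)
Lemma integral_lines_zero F (M : R) i : continuous F ->
  (forall x, ~ cube M x -> F x = 0) ->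
  (forall x, \int[leb]_t (F (set_coord i x t))%:E = 0)%E ->
  (\int[leb3]_x (F x)%:E = 0)%E.
Proof.
move=> cF F0 lF.
have iF : leb3.-integrable setT (EFin \o F : M3 -> \bar R) by exact: continuous_support_integrable F0.
case: i lF => [[|[|[|//]]]] /= ii lF.
- apply: etrans; first exact: (esym (@integral21_prod_meas1 _ _ _ _ _ (leb2S R) (leb1 R) _ iF)).
  apply: integral0_eq => z _.
  apply: etrans; first exact: (esym (@integral21_prod_meas1 _ _ _ _ _ (leb1 R) (leb1 R) _ (section_integrable z cF F0))).
  by apply: integral0_eq => y _; exact: (lF (0, y, z)).
- apply: etrans; first exact: (esym (@integral21_prod_meas1 _ _ _ _ _ (leb2S R) (leb1 R) _ iF)).
  apply: integral0_eq => z _.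
  apply: etrans; first exact: (esym (@integral12_prod_meas1 _ _ _ _ _ (leb1 R) (leb1 R) _ (section_integrable z cF F0))).
  by apply: integral0_eq => x _; exact: (lF (x, 0, z)).
apply: etrans; first exact: (esym (@integral12_prod_meas1 _ _ _ _ _ (leb2S R) (leb1 R) _ iF)).
by apply: integral0_eq => p _; exact: (lF (p, 0)).
Qed.

Lemma integral_compact_deriv (G h : R -> R) (M : R) : 0 < M ->
  (forall t, has_deriv G t (h t)) -> continuous h ->
  (forall t, M < `|t| -> h t = 0) -> (forall t, M < `|t| -> G t = 0) ->
  (\int[leb]_t (h t)%:E = 0)%E.
Proof.
move=> M0 dG ch h0 G0.
have -> : (fun t => (h t)%:E) = (EFin \o h) \_ `[(- (M + 1))%R, (M + 1)%R].
  apply/funext => t; rewrite patchE; case: ifPn => // /negP.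
  rewrite inE /= in_itv /= -ler_norml => /negP; rewrite -ltNge => Mt.
  by rewrite h0 // (lt_trans _ Mt) // ltrDl.
rewrite -integral_mkcond (@integral_has_deriv _ h G) //.
- by rewrite !G0 ?subrr // ?normrN gtr0_norm ?ltrDl // addr_gt0.
- by rewrite lt_neqAle; lra.
- by move=> t _; exact: ch.
Qed.

Lemma continuous_coord i : continuous (coord i).
Proof.
move=> [[a b] c].
have c1 : (fun x : E3 => x.1) x @[x --> (a, b, c)] --> (a, b) by exact: cvg_fst.
rewrite /continuous_at /coord; case: (val i) => [|[|n]] /=.
- by apply: (@cvg_comp _ _ _ (fun x : E3 => x.1) (fun y => y.1) _ _ _ c1); exact: cvg_fst.
- by apply: (@cvg_comp _ _ _ (fun x : E3 => x.1) (fun y => y.2) _ _ _ c1); exact: cvg_snd.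
- exact: cvg_snd.
Qed.

Lemma continuous_set_coord i x : continuous (set_coord i x).
Proof.
move=> t; rewrite /continuous_at /set_coord; case: (val i) => [|[|n]].
- exact: cvg_pair (cvg_pair cvg_id (cvg_cst _)) (cvg_cst _).
- exact: cvg_pair (cvg_pair (cvg_cst _) cvg_id) (cvg_cst _).
- exact: cvg_pair (cvg_cst _) cvg_id.
Qed.

Section regularised.
Variables (e : R) (w w1 w2 : R -> R).
Hypothesis e0 : 0 < e.
Hypothesis dw : forall s, 0 < s -> has_deriv w s (w1 s).
Hypothesis dw1 : forall s, 0 < s -> has_deriv w1 s (w2 s).
Hypothesis cw2 : forall s, 0 < s -> {for s, continuous w2}.

Let s x := reg e x.
Let s0 x : 0 < s x. Proof. exact: reg_gt0. Qed.

(** First and second partial derivatives of w(s) in the direction i, by the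
    chain rule and ds/dx_i = x_i / s. *)
Definition reg1 i x : R := w1 (s x) * coord i x / s x.
Definition reg2 i x : R :=
  w2 (s x) * coord i x ^+ 2 / s x ^+ 2 + w1 (s x) * ((s x)^-1 - coord i x ^+ 2 / s x ^+ 3).

Lemma reg_line i x t : has_deriv (fun t => s (set_coord i x t)) t (t / s (set_coord i x t)).
Proof.
pose c := e + (x.1.1 ^+ 2 + x.1.2 ^+ 2 + x.2 ^+ 2 - coord i x ^+ 2).
have E y : s (set_coord i x y) = Num.sqrt (c + y ^+ 2).
  rewrite /s /reg /c /coord /set_coord; congr Num.sqrt.
  by case: (val i) => [|[|n]] /=; ring.
have c0 y : 0 < c + y ^+ 2 by rewrite -sqrtr_gt0 -E.
have -> : (fun t => s (set_coord i x t)) = (fun t => Num.sqrt (c + t ^+ 2)) by apply/funext => y.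
rewrite E; apply: D_eq; first by derive_auto.
by rewrite /=; field; rewrite gt_eqF // sqrtr_gt0.
Qed.

Lemma reg1_line i x t :
  has_deriv (fun t => w (s (set_coord i x t))) t (reg1 i (set_coord i x t)).
Proof.
apply: D_eq; first exact: (@D_comp _ w _ t _ _ (dw (s0 _)) (reg_line i x t)).
by rewrite /reg1 coord_set mulrA.
Qed.

Lemma reg2_line i x t :
  has_deriv (fun t => reg1 i (set_coord i x t)) t (reg2 i (set_coord i x t)).
Proof.
have -> : (fun t => reg1 i (set_coord i x t)) =
    (fun t => w1 (s (set_coord i x t)) * t * (s (set_coord i x t))^-1).
  by apply/funext => y; rewrite /reg1 coord_set.
apply: D_eq.
  apply: D_mul; [apply: D_mul; [exact: (@D_comp _ w1 _ t _ _ (dw1 (s0 _)) (reg_line i x t))|exact: D_id]|].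
  by apply: D_inv (reg_line i x t); rewrite gt_eqF.
by rewrite /reg2 coord_set; field; rewrite gt_eqF.
Qed.

Lemma comp_reg_continuous (f1 : R -> R) : (forall t, 0 < t -> {for t, continuous f1}) ->
  continuous (fun x => f1 (s x) : R).
Proof.
by move=> cf x; apply: (@continuous_comp _ _ _ s f1); [exact: continuous_reg|exact: cf].
Qed.

Lemma reg2_continuous i : continuous (reg2 i).
Proof.
have cs n : continuous (fun x => (s x ^+ n)^-1).
  apply: (@comp_reg_continuous (fun t => (t ^+ n)^-1)) => t t0.
  by apply: cvgV; [rewrite gt_eqF ?exprn_gt0|exact: exprn_continuous].
have cc : continuous (fun x => coord i x ^+ 2).
  by move=> x; apply: (@continuous_comp _ _ _ (coord i) (fun t => t ^+ 2));
    [exact: continuous_coord|exact: exprn_continuous].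
move=> x; apply: cvgD.
  apply: cvgM; last exact: cs.
  by apply: cvgM; [exact: (comp_reg_continuous cw2)|exact: cc].
apply: cvgM; first by apply: comp_reg_continuous => t t0; exact: D_continuous (dw1 t0).
apply: cvgB; first exact: (cs 1%N).
by apply: cvgM; [exact: cc|exact: cs].
Qed.

(** On every line parallel to the axis i, (d_i^2 g) w(s) - g d_i^2 (w(s)) is the
    derivative of (d_i g) w(s) - g d_i (w(s)), which has compact support; so its
    integral vanishes. Summing over i, with r^2 = s^2 - e, turns the sum of the
    second derivatives of w(s) into
    w''(s) (1 - e / s^2) + w'(s) (2 / s + e / s^3). *)
Lemma green_reg g (M : R) : 0 < M -> smooth g -> (forall x, M < `|x| -> g x = 0) ->
  let f x := laplacian g x * w (s x) -
     g x * (w2 (s x) * (1 - e / s x ^+ 2) + w1 (s x) * (2 / s x + e / s x ^+ 3)) in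
  leb3.-integrable setT (EFin \o f : M3 -> \bar R) /\ (\int[leb3]_x (f x)%:E = 0)%E.
Proof.
move=> M0 sg g0 f.
have pv := partials_vanish g0.
pose F i x := partials [:: i; i] g x * w (s x) - g x * reg2 i x.
pose G i x := partials [:: i] g x * w (s x) - g x * reg1 i x.
have cw : continuous (fun x => w (s x)).
  by apply: comp_reg_continuous => t t0; exact: D_continuous (dw t0).
have cF i : continuous (F i).
  move=> x; apply: cvgB; apply: cvgM.
  - exact: (sg [:: i; i]).1.
  - exact: cw.
  - exact: (sg [::]).1.
  - exact: reg2_continuous.
have F0 i x : M < `|x| -> F i x = 0 by move=> Mx; rewrite /F pv // g0 // !mul0r subrr.
have F0' i x : ~ cube M x -> F i x = 0 by move=> /not_cube; exact: F0.
have big i x t : M < `|t| -> M < `|set_coord i x t|.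
  by move=> Mt; rewrite (lt_le_trans Mt) // -{1}(coord_set i x t) coord_le_norm.
have intF i : (\int[leb3]_x (F i x)%:E = 0)%E.
  apply: (integral_lines_zero (i := i) (cF i) (F0' i)) => x.
  apply: (@integral_compact_deriv (fun t => G i (set_coord i x t)) _ M) => //.
  - move=> t; have dg := has_deriv_line ((sg [::]).2 i (set_coord i x t)).
    have dg1 := has_deriv_line ((sg [:: i]).2 i (set_coord i x t)).
    apply: D_eq.
      apply: D_add; first exact: D_mul dg1 (reg1_line i x t).
      by apply: D_opp; exact: D_mul dg (reg2_line i x t).
    by rewrite /F /=; ring.
  - move=> t; apply: (@continuous_comp _ _ _ (set_coord i x) (F i)); last exact: cF.
    exact: continuous_set_coord.
  - by move=> t Mt; apply: F0; exact: big.
  - by move=> t Mt; rewrite /G pv ?g0 ?mul0r ?subrr //; exact: big.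
have fE : (EFin \o f : M3 -> \bar R) = (fun x : M3 => \sum_(i <- index_enum 'I_3) (F i x)%:E)%E.
  apply/funext => x; rewrite sumEFin; congr EFin.
  rewrite /F sumrB -mulr_suml -mulr_sumr /f /laplacian; congr (_ - _ * _).
  rewrite !big_ord_recl big_ord0 /reg2 /coord /=.
  have sE : s x ^+ 2 = e + (x.1.1 ^+ 2 + x.1.2 ^+ 2 + x.2 ^+ 2).
    by rewrite sqr_sqrtr // addr_ge0 ?sqnorm_ge0 // ltW.
  have -> : e = s x ^+ 2 - (x.1.1 ^+ 2 + x.1.2 ^+ 2 + x.2 ^+ 2) by rewrite sE addrK.
  by field; rewrite gt_eqF.
have iF i : leb3.-integrable setT (fun x : M3 => (F i x)%:E).
  exact: continuous_support_integrable (F0' i).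
split; first by rewrite fE; exact: (@integrable_sum _ M3 R leb3 setT measurableT).
rewrite (_ : (fun x => (f x)%:E) = EFin \o f) // fE integral_sum //.
by apply: big1 => i _.
Qed.
End regularised.
End green.

(** * Singular radial functions *)

Section radial.
Variable R : realType.
Local Notation E3 := (R * R * R)%type.
Local Notation MR := (measurableTypeR R).
Local Notation M3 := (measurableTypeR R * measurableTypeR R * measurableTypeR R)%type.
Local Notation leb3 := (@leb3 R).
Implicit Types (g : E3 -> R) (x : E3).

Lemma norm3_reg x : norm3 x = reg 0 x.
Proof. by rewrite /norm3 /reg add0r. Qed.

Lemma norm3_ge0 x : 0 <= norm3 x. Proof. exact: sqrtr_ge0. Qed.

Lemma norm3_sqr x : norm3 x ^+ 2 = x.1.1 ^+ 2 + x.1.2 ^+ 2 + x.2 ^+ 2.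
Proof. by rewrite sqr_sqrtr ?sqnorm_ge0. Qed.

Lemma reg_sqr e x : 0 <= e -> reg e x ^+ 2 = e + norm3 x ^+ 2.
Proof. by move=> e0; rewrite norm3_sqr sqr_sqrtr // addr_ge0 ?sqnorm_ge0. Qed.

Lemma continuous_norm3 : continuous (@norm3 R).
Proof.
rewrite (_ : @norm3 R = reg 0); first exact: continuous_reg.
by apply/funext => x; exact: norm3_reg.
Qed.

Lemma coord_le_norm3 i x : `|coord i x| <= norm3 x.
Proof.
rewrite -sqrtr_sqr ler_wsqrtr // /coord.
have h1 := sqr_ge0 x.1.1; have h2 := sqr_ge0 x.1.2; have h3 := sqr_ge0 x.2.
by case: (val i) => [|[|n]]; lra.
Qed.

Lemma norm_le_norm3 x : `|x| <= norm3 x.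
Proof.
rewrite !prod_normE /= !ge_max.
by rewrite (coord_le_norm3 0) (coord_le_norm3 1) (coord_le_norm3 2%:R).
Qed.

Lemma norm3_le_cube (M : R) x : cube M x -> norm3 x ^+ 2 <= 3 * M ^+ 2.
Proof.
have sq (t : R) : `[- M, M]%classic t -> t ^+ 2 <= M ^+ 2.
  by rewrite /= in_itv /= -ler_norml => tM; rewrite -(real_normK (num_real t)) lerXn2r // nnegrE (le_trans _ tM).
by move=> [[/sq h1 /sq h2] /sq h3]; rewrite norm3_sqr; lra.
Qed.

(** The origin is a degenerate cube. *)
Lemma ae_norm3_gt0 : {ae leb3, forall x : M3, 0 < norm3 (x : E3)}.
Proof.
exists (cube 0); split; first exact: cube_measurable.
  have mI : measurable (`[- 0, 0]%classic : set MR) by exact: measurable_itv.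
  have e3 : (leb3 (cube 0) = _)%E :=
    @product_measure1E _ _ _ _ _ (leb2S R) (leb1 R) _ _ (measurableX mI mI) mI.
  by rewrite e3 /leb1 /= oppr0 lebesgue_measure_itv /= ltxx mule0.
move=> x /= /negP; rewrite -leNgt => x0.
by apply/cubeP; exact: le_trans (norm_le_norm3 x) x0.
Qed.

(** phi may be discontinuous at 0; on the open half line it is Borel. *)
Lemma radial_measurable (phi : R -> R) :
  (forall t, 0 < t -> {for t, continuous phi}) -> phi 0 = 0 ->
  measurable_fun setT ((fun x => phi (norm3 x)) : M3 -> R).
Proof.
move=> cp p0.
rewrite (_ : (fun x => _) = (phi \_ `]0, +oo[%classic) \o (@norm3 R)); last first.
  apply/funext => x /=; rewrite patchE; case: ifPn => // /negP.
  rewrite inE /= in_itv /= andbT => /negP; rewrite -leNgt => x0.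
  by have -> : norm3 x = 0 by apply/eqP; rewrite eq_le x0 norm3_ge0.
apply: (@measurableT_comp _ _ _ _ _ _ (phi \_ `]0, +oo[%classic)); last first.
  exact: continuous3_measurable continuous_norm3.
apply/(measurable_restrictT _ _).1; first exact: measurable_itv.
apply: open_continuous_measurable_fun; first exact: interval_open.
by move=> t; rewrite inE /= in_itv /= andbT; exact: cp.
Qed.

(** A singularity of order 5/2 < 3 is integrable in dimension three. *)
Lemma singular_integrable (f : E3 -> R) (M K : R) : 0 < M ->
  measurable_fun setT (f : M3 -> R) -> (forall x, ~ cube M x -> f x = 0) ->
  (forall x, cube M x -> `|f x| <= K / (norm3 x ^+ 2 * Num.sqrt (norm3 x))) ->
  leb3.-integrable setT (EFin \o f : M3 -> \bar R).
Proof.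
move=> M0 mf f0 fK.
apply: (@le_integrable _ M3 R leb3 setT measurableT (EFin \o f) (fun x => `|K|%:E * majorant M x)%E) => //.
- exact/measurable_EFinP.
- move=> x _.
  have km0 : (0 <= `|K|%:E * majorant M x)%E by apply: mule_ge0 => //; exact: majorant_ge0.
  rewrite [leRHS]gee0_abs //=.
  have [cx|cx] := pselect (cube M x); last first.
    by rewrite f0 // normr0.
  have := norm3_ge0 x; rewrite le_eqVlt => /predU1P[r0|r0].
    have := fK _ cx; rewrite -r0 expr0n /= mul0r invr0 mulr0 normr_le0 => /eqP ->.
    by rewrite normr0.
  apply: (@le_trans _ _ (`|K|%:E * ((norm3 x ^+ 2 * Num.sqrt (norm3 x))^-1)%:E)%E).
    rewrite -EFinM lee_fin (le_trans (fK _ cx)) // ler_wpM2r ?ler_norm //.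
    by rewrite invr_ge0 mulr_ge0 ?sqr_ge0 ?sqrtr_ge0.
  apply: lee_wpmul2l; first by rewrite lee_fin.
  by apply: majorant_ge => //; [exact: (coord_le_norm3 0)|exact: (coord_le_norm3 1)|exact: (coord_le_norm3 2%:R)].
- by apply: (@integrableZl _ M3 R leb3 setT measurableT); exact: majorant_integrable.
Qed.

(** The singularity B / r^2 is absorbed in a multiple of r^(-5/2) on the cube. *)
Lemma radial_integrable (h : E3 -> R) (v : R -> R) (M A B : R) : 0 < M ->
  measurable_fun setT (h : M3 -> R) -> (forall x, `|h x| <= A) ->
  (forall x, ~ cube M x -> h x = 0) ->
  (forall t, 0 < t -> {for t, continuous v}) ->
  (forall t, 0 < t -> t ^+ 2 <= 3 * M ^+ 2 -> `|v t| <= B / t) ->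
  leb3.-integrable setT (EFin \o (fun x => h x * (v (norm3 x) / norm3 x)) : M3 -> \bar R).
Proof.
move=> M0 mh hA h0 cv vB.
have A0 : 0 <= A by exact: le_trans (normr_ge0 _) (hA (0, 0, 0)).
apply: (@singular_integrable _ M (A * B * Num.sqrt (3 * M + 1))) => //.
- apply: measurable_funM => //.
  apply: (@radial_measurable (fun t => v t / t)) => [t t0|]; last by rewrite invr0 mulr0.
  by apply: cvgM; [exact: cv|apply: cvgV; [rewrite gt_eqF|exact: cvg_id]].
- by move=> x cx; rewrite h0 // mul0r.
move=> x cx; have := norm3_ge0 x; rewrite le_eqVlt => /predU1P[<-|r0].
  by rewrite invr0 !mulr0 normr0 expr0n /= mul0r invr0 mulr0.
have r2 := norm3_le_cube cx.
move: (norm3 x) r0 r2 => r r0 r2.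
have q0 : 0 < Num.sqrt r by rewrite sqrtr_gt0.
rewrite ler_pdivlMr ?mulr_gt0 ?exprn_gt0 // !normrM normfV (gtr0_norm r0).
rewrite (_ : _ * (_ * Num.sqrt r) = `|h x| * (`|v r| * r) * Num.sqrt r); last by field; rewrite gt_eqF.
have rS : r <= 3 * M + 1 by nra.
by rewrite !ler_pM ?mulr_ge0 ?sqrtr_ge0 ?(ltW r0) ?ler_wsqrtr // -ler_pdivlMr // vB.
Qed.

Lemma lipschitz_line (f f' : R -> R) (A : R) : (forall t, has_deriv f t (f' t)) ->
  (forall t, `|f' t| <= A) -> forall a b, `|f b - f a| <= A * `|b - a|.
Proof.
move=> df fA a b; wlog ab : a b / a <= b => [H|].
  by have [/H//|/ltW/H] := leP a b; rewrite distrC [`|a - b|]distrC.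
have [| |c _ ->] := @MVT_segment R f f' a b ab.
- by move=> t _; exact: df.
- by apply: continuous_subspaceT => t; exact: D_continuous (df t).
by rewrite normrM ler_wpM2r.
Qed.

Lemma bounded_of_support (f : E3 -> R) (M : R) : continuous f ->
  (forall x, M < `|x| -> f x = 0) -> exists A, forall x, `|f x| <= A.
Proof.
move=> cf f0; have [C hC] := continuous_bounded_cube M cf.
exists `|C| => x; have [Mx|xM] := ltP M `|x|; first by rewrite f0 // normr0.
by rewrite (le_trans (hC x _)) ?ler_norm //; apply/cubeP.
Qed.

(** The point is joined to the origin by three segments parallel to the axes, and
    the first partial derivatives are bounded. *)
Lemma test_lipschitz g (M : R) : smooth g -> (forall x, M < `|x| -> g x = 0) ->
  exists2 A, 0 <= A & forall x, `|g x - g (0, 0, 0)| <= A * norm3 x.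
Proof.
move=> sg g0.
have [A hA] : exists A : R, forall i x, `|partials [:: i] g x| <= A.
  have b i : exists C, forall x, `|partials [:: i] g x| <= C := bounded_of_support (sg [:: i]).1 (partials_vanish g0 [:: i]).
  have /choice[B hB] := b; exists (\sum_(i < 3) `|B i|) => i x.
  rewrite (bigD1 i) //= (le_trans (hB i x)) // (le_trans (ler_norm _)) //.
  by rewrite lerDl sumr_ge0.
have A0 : 0 <= A by exact: le_trans (normr_ge0 _) (hA 0 (0, 0, 0)).
exists (A * 3) => [|x]; first by rewrite mulr_ge0.
have step i y : `|g y - g (set_coord i y 0)| <= A * `|coord i y|.
  rewrite -{1}(set_coordK i y) -[coord i y in leRHS]subr0.
  apply: (@lipschitz_line (fun t => g (set_coord i y t)) (fun t => partials [:: i] g (set_coord i y t))).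
    by move=> t; exact: has_deriv_line ((sg [::]).2 i (set_coord i y t)).
  by move=> t; exact: hA.
case: x => [[a b] c].
have := step 0 (a, b, c); have := step 1 (0, b, c); have := step 2%:R (0, 0, c).
have := coord_le_norm3 0 (a, b, c); have := coord_le_norm3 1 (a, b, c); have := coord_le_norm3 2%:R (a, b, c).
rewrite /coord /set_coord /=; move: (norm3 _) => r h3 h2 h1 s3 s2 s1.
have tri : `|g (a, b, c) - g (0, 0, 0)| <= A * `|a| + A * `|b| + A * `|c|.
  have -> : g (a, b, c) - g (0, 0, 0) = (g (a, b, c) - g (0, b, c)) + (g (0, b, c) - g (0, 0, c)) + (g (0, 0, c) - g (0, 0, 0)) by ring.
  by rewrite (le_trans (ler_normD _ _)) // lerD // (le_trans (ler_normD _ _)) // lerD.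
apply: le_trans tri _; nra.
Qed.

(** The estimate behind the dominated convergence, with q = sqrt s and
    eta = e / s^2. All terms but one are bounded separately. The term
    3 eta gx v / q^6 is one order too singular, and only its difference with
    3 eta g0 u0 / q^6 is bounded by q^(-5): gx v - g0 u0 is of order q, since u
    varies by sqrt s and g by s near the origin. *)
Lemma regularised_bound (A C T u0 : R) : 0 <= A -> 0 <= C -> 0 <= T ->
  exists2 K, 0 <= K & forall q eta L gx g0 v v1 v2 : R,
    0 < q <= T -> 0 <= eta <= 1 -> `|L| <= A -> `|gx| <= A ->
    `|gx - g0| <= A * q ^+ 2 -> `|v - u0| <= C * q -> `|v1| <= C / q ->
    `|v2| <= C / q ^+ 2 ->
    `|L * (v / q ^+ 2) - gx * (v2 / q ^+ 2 * (1 - eta) + 3 * eta * v1 / q ^+ 4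
        - 3 * eta * v / q ^+ 6) - g0 * u0 * (3 * eta / q ^+ 6)| <= K / q ^+ 5.
Proof.
move=> A0 C0 T0.
pose k1 := A * (`|u0| + C * T) * T ^+ 3.
pose k2 := A * C * T.
pose k3 := 3 * (A * C).
pose k4 := 3 * (A * C + A * T * `|u0|).
have k10 : 0 <= k1 by rewrite !mulr_ge0 ?exprn_ge0 ?addr_ge0 ?mulr_ge0.
have k20 : 0 <= k2 by rewrite !mulr_ge0.
have k30 : 0 <= k3 by rewrite !mulr_ge0.
have k40 : 0 <= k4 by rewrite !mulr_ge0 ?addr_ge0 ?mulr_ge0.
exists (k1 + k2 + k3 + k4); first by rewrite !addr_ge0.
move=> q eta L gx g0 v v1 v2 /andP[q0 qT] /andP[eta0 eta1] LA gA gg vu v1C v2C.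
have qn : q != 0 by rewrite gt_eqF.
have qpos n : 0 <= q ^+ n by rewrite exprn_ge0 // ltW.
have vb : `|v| <= `|u0| + C * T.
  rewrite -(subrK u0 v) (le_trans (ler_normD _ _)) // addrC lerD2l (le_trans vu) //.
  by rewrite ler_wpM2l.
have b1 : `|L * (v / q ^+ 2)| * q ^+ 5 <= k1.
  rewrite !normrM normfV (ger0_norm (qpos 2)).
  rewrite (_ : _ * q ^+ 5 = `|L| * `|v| * q ^+ 3); last by field.
  by rewrite !ler_pM ?mulr_ge0 ?lerXn2r ?nnegrE // ltW.
have b2 : `|gx * (v2 / q ^+ 2)| * q ^+ 5 <= k2.
  rewrite !normrM normfV (ger0_norm (qpos 2)).
  rewrite (_ : _ * q ^+ 5 = `|gx| * (`|v2| * q ^+ 2) * q); last by field.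
  rewrite !ler_pM ?mulr_ge0 ?(ltW q0) //.
  by rewrite -ler_pdivlMr ?exprn_gt0.
have b3 : `|3 * gx * v1 / q ^+ 4| * q ^+ 5 <= k3.
  rewrite !normrM normfV (ger0_norm (qpos 4)) ger0_norm //.
  rewrite (_ : _ * q ^+ 5 = 3 * (`|gx| * (`|v1| * q))); last by field.
  by rewrite ler_wpM2l // ler_pM ?mulr_ge0 ?(ltW q0) // -ler_pdivlMr.
have b4 : `|3 * (gx * v - g0 * u0) / q ^+ 6| * q ^+ 5 <= k4.
  rewrite !normrM normfV (ger0_norm (qpos 6)) ger0_norm //.
  rewrite (_ : _ * q ^+ 5 = 3 * (`|gx * v - g0 * u0| / q)); last by field.
  rewrite ler_wpM2l // ler_pdivrMr //.
  have -> : gx * v - g0 * u0 = gx * (v - u0) + (gx - g0) * u0 by ring.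
  rewrite (le_trans (ler_normD _ _)) // [leRHS]mulrDl lerD // normrM.
    by rewrite -mulrA ler_pM.
  rewrite (_ : _ * q = (A * (T * q)) * `|u0|); last by ring.
  rewrite ler_wpM2r // (le_trans gg) // ler_wpM2l // expr2 ler_wpM2r // ltW //.
rewrite ler_pdivlMr ?exprn_gt0 //.
set P1 := L * (v / q ^+ 2) in b1 *; set P2 := gx * (v2 / q ^+ 2) in b2 *.
set P3 := 3 * gx * v1 / q ^+ 4 in b3; set P4 := 3 * (gx * v - g0 * u0) / q ^+ 6 in b4.
rewrite (_ : _ - g0 * u0 * _ = P1 - (1 - eta) * P2 - eta * P3 + eta * P4); last first.
  by rewrite /P2 /P3 /P4; field.
apply: (@le_trans _ _ ((`|P1| + `|P2| + `|P3| + `|P4|) * q ^+ 5)); last by rewrite !mulrDl; lra.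
rewrite ler_wpM2r //.
have h (t P : R) : 0 <= t <= 1 -> `|t * P| <= `|P|.
  by move=> /andP[t0 t1]; rewrite normrM (ger0_norm t0) ler_piMl.
rewrite (le_trans (ler_normD _ _)) // lerD ?h ?eta0 //.
rewrite (le_trans (ler_normB _ _)) // lerD ?h ?eta0 //.
rewrite (le_trans (ler_normB _ _)) // lerD ?h //.
by apply/andP; split; lra.
Qed.

Section radial_green.
Variables (u u1 u2 : R -> R) (u0 : R).
Hypothesis du : forall s, 0 < s -> has_deriv u s (u1 s).
Hypothesis du1 : forall s, 0 < s -> has_deriv u1 s (u2 s).
Hypothesis cu2 : forall s, 0 < s -> {for s, continuous u2}.
Hypothesis u_bound : forall S, 0 < S -> exists2 C, 0 <= C & forall s, 0 < s <= S ->
  [/\ `|u s - u0| <= C * Num.sqrt s, `|u1 s| <= C / Num.sqrt s & `|u2 s| <= C / s].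

Variables (g : E3 -> R) (M : R).
Hypothesis M1 : 1 <= M.
Hypothesis sg : smooth g.
Hypothesis g0 : forall x, M < `|x| -> g x = 0.

Let M0 : 0 < M. Proof. exact: lt_le_trans M1. Qed.
Let g00 := g (0, 0, 0).

(** (Delta g) k - g (Delta k) for k = u(s) / s, after subtracting the part that
    concentrates at the origin. At e = 0 it is the integrand of
    [radial_green]. *)
Definition smoothed (e : R) (x : E3) : R :=
  let s := reg e x in
  laplacian g x * (u s / s)
  - g x * (u2 s / s * (1 - e / s ^+ 2) + 3 * e * u1 s / s ^+ 4 - 3 * e * u s / s ^+ 5)
  - g00 * u0 * (3 * e / s ^+ 5).

Lemma laplacian_continuous : continuous (laplacian g).
Proof.
have cs (s : seq 'I_3) : continuous (fun x => \sum_(i <- s) partials [:: i; i] g x).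
  elim: s => [|i s IH].
    rewrite (_ : (fun x => _) = cst 0); first by move=> x; exact: cvg_cst.
    by apply/funext => x; rewrite big_nil.
  rewrite (_ : (fun x => _) = (fun x => partials [:: i; i] g x + \sum_(i <- s) partials [:: i; i] g x)).
    by move=> x; apply: cvgD; [exact: (sg [:: i; i]).1|exact: IH].
  by apply/funext => x; rewrite big_cons.
exact: cs.
Qed.

Lemma laplacian_vanish x : M < `|x| -> laplacian g x = 0.
Proof. by move=> Mx; rewrite /laplacian big1 // => i _; exact: (partials_vanish g0 [:: i; i]). Qed.

Lemma mass_integrable (e : R) : 0 < e ->
  leb3.-integrable setT ((fun x => (3 * e / reg e x ^+ 5)%:E) : M3 -> \bar R).
Proof.
move=> e0; apply/integrableP; split.
  apply/measurable_EFinP; apply: continuous3_measurable => x.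
  apply: cvgM; first exact: cvg_cst.
  apply: (@comp_reg_continuous _ _ e0 (fun t => (t ^+ 5)^-1)) => t t0.
  by apply: cvgV; [rewrite gt_eqF ?exprn_gt0|exact: exprn_continuous].
under eq_integral => x _.
  rewrite gee0_abs; last first.
    by rewrite lee_fin divr_ge0 ?exprn_ge0 ?mulr_ge0 ?(ltW (reg_gt0 _ _)) // ltW.
  over.
by rewrite mass_reg // ltry.
Qed.

(** Green's identity kills all terms but the subtracted one, whose integral is
    known from [mass_reg]. *)
Lemma smoothed_integral (e : R) : 0 < e ->
  leb3.-integrable setT (EFin \o smoothed e : M3 -> \bar R) /\
  (\int[leb3]_x (smoothed e x)%:E = (- (4 * pi * u0 * g00))%:E)%E.
Proof.
move=> e0.
have dw s : 0 < s -> has_deriv (fun s => u s / s) s (u1 s / s - u s / s ^+ 2).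
  move=> s0; apply: D_eq.
    by apply: D_mul (du s0) _; apply: D_inv (D_id s); rewrite gt_eqF.
  by rewrite /=; field; rewrite gt_eqF.
have dw1 s : 0 < s -> has_deriv (fun s => u1 s / s - u s / s ^+ 2) s
    (u2 s / s - 2 * u1 s / s ^+ 2 + 2 * u s / s ^+ 3).
  move=> s0; have sn : s != 0 by rewrite gt_eqF.
  apply: D_eq.
    apply: D_add; first by apply: D_mul (du1 s0) _; apply: D_inv (D_id s).
    apply: D_opp; apply: D_mul (du s0) _; apply: D_inv; last by apply: (@D_exp _ (fun t => t) 1); exact: D_id.
    by rewrite expf_neq0.
  by rewrite /=; field.
have cw2 s : 0 < s -> {for s, continuous (fun s => u2 s / s - 2 * u1 s / s ^+ 2 + 2 * u s / s ^+ 3)}.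
  move=> s0; have sn : s != 0 by rewrite gt_eqF.
  have cs n : {for s, continuous (fun s : R => (s ^+ n)^-1)}.
    by apply: cvgV; [rewrite expf_neq0|exact: exprn_continuous].
  apply: cvgD; [apply: cvgB|]; (apply: cvgM; last by [exact: (cs 1%N)|exact: cs]).
  - exact: cu2.
  - by apply: cvgM; [exact: cvg_cst|exact: (D_continuous (du1 s0))].
  - by apply: cvgM; [exact: cvg_cst|exact: (D_continuous (du s0))].
have [] := green_reg e0 dw dw1 cw2 M0 sg g0.
set f := (X in EFin \o X) => iF intF.
have im := mass_integrable e0.
have imc : leb3.-integrable setT (EFin \o (fun x => g00 * u0 * (3 * e / reg e x ^+ 5)) : M3 -> \bar R).
  have := @integrableZl _ M3 R leb3 setT measurableT (g00 * u0) _ im.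
  by apply: eq_integrable => // x _; rewrite /= EFinM.
have fE : smoothed e = (fun x => f x - g00 * u0 * (3 * e / reg e x ^+ 5)).
  apply/funext => x; rewrite /smoothed /f /=; congr (_ - _ * _ - _).
  by field; rewrite gt_eqF // reg_gt0.
rewrite fE; split.
  have := @integrableB _ M3 R leb3 setT measurableT _ _ iF imc.
  by apply: eq_integrable => // x _; rewrite /= EFinB.
rewrite (_ : (fun x => _) = (fun x => (f x)%:E - (g00 * u0 * (3 * e / reg e x ^+ 5))%:E)%E); last first.
  by apply/funext => x; rewrite EFinB.
rewrite (@integralB_EFin _ M3 R leb3 setT _ _ measurableT iF imc) intF sub0e.
under eq_integral do rewrite EFinM.
rewrite (@integralZl _ M3 R leb3 setT measurableT _ im) mass_reg // -EFinM -EFinN.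
by congr EFin; ring.
Qed.

(** On the cube, which contains the support of g, the bound is the singular one
    and does not see e, because |x_i| <= s. Off the cube only the subtracted
    kernel remains; there r >= 1 and e <= 1, whence sqrt (1 + r^2) <= 2 s, and
    32 = 2^5. *)
Lemma smoothed_bound : exists2 K, 0 <= K & forall e x, 0 < e <= 1 ->
  ((`|smoothed e x|)%:E <= K%:E * majorant M x
     + (`|g00 * u0| * 32)%:E * (3 * 1 / reg 1 x ^+ 5)%:E)%E.
Proof.
have [A1 A10 hA1] := test_lipschitz sg g0.
have [A2 hA2] := bounded_of_support (sg [::]).1 g0.
have [A3 hA3] := bounded_of_support laplacian_continuous laplacian_vanish.
pose S := 1 + 3 * M ^+ 2; have S1 : 1 <= S by rewrite lerDl mulr_ge0 ?sqr_ge0.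
have S0 : 0 < S by apply: lt_le_trans S1.
have [C C0 hC] := u_bound S0.
pose A := A1 + `|A2| + `|A3|.
have A0 : 0 <= A by rewrite !addr_ge0.
have [K K0 hK] := regularised_bound u0 A0 C0 (sqrtr_ge0 S).
exists K => // e x /andP[e0 e1].
have s0 := reg_gt0 e0 x.
have s2 := reg_sqr x (ltW e0).
have maj0 := majorant_ge0 M x.
have rest0 : (0 <= (`|g00 * u0| * 32)%:E * (3 * 1 / reg 1 x ^+ 5)%:E)%E.
  by rewrite -EFinM lee_fin !mulr_ge0 // invr_ge0 exprn_ge0 // sqrtr_ge0.
have [cx|cx] := pselect (cube M x).
  apply: (@le_trans _ _ (K%:E * majorant M x)%E); last by rewrite leeDl.
  have sr : norm3 x <= reg e x by rewrite ler_wsqrtr // lerDr ltW.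
  have maj : (((reg e x ^+ 2 * Num.sqrt (reg e x))^-1)%:E <= majorant M x)%E.
    by apply: majorant_ge => //; rewrite (le_trans _ sr) //;
      [exact: (coord_le_norm3 0)|exact: (coord_le_norm3 1)|exact: (coord_le_norm3 2%:R)].
  apply: le_trans (lee_wpmul2l _ maj); last by rewrite lee_fin.
  rewrite -EFinM lee_fin.
  set q := Num.sqrt (reg e x).
  have q0 : 0 < q by rewrite sqrtr_gt0.
  have sq : reg e x = q ^+ 2 by rewrite sqr_sqrtr // ltW.
  have sS : reg e x <= S.
    have h1 := norm3_le_cube cx; have : reg e x ^+ 2 <= S by rewrite s2 /S; lra.
    by move=> h2; nra.
  have es : e <= reg e x ^+ 2 by rewrite s2 lerDl sqr_ge0.
  have [|bu bu1 bu2] := hC (reg e x); first by rewrite s0.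
  have hh := hK q (e / reg e x ^+ 2) (laplacian g x) (g x) g00 (u (reg e x)) (u1 (reg e x)) (u2 (reg e x)).
  rewrite /smoothed -/g00.
  have -> : K / (reg e x ^+ 2 * q) = K / q ^+ 5 by rewrite sq; field; rewrite gt_eqF.
  apply: le_trans (hh _ _ _ _ _ _ _ _).
  - rewrite le_eqVlt; apply/orP; left; apply/eqP; congr `| _ |.
    by rewrite sq; field; rewrite gt_eqF.
  - by rewrite q0 ler_wsqrtr.
  - apply/andP; split; first by rewrite divr_ge0 ?sqr_ge0 // ltW.
    by rewrite ler_pdivrMr ?exprn_gt0 // mul1r.
  - by rewrite (le_trans (hA3 x)) // (le_trans (ler_norm _)) // /A lerDr addr_ge0.
  - by rewrite (le_trans (hA2 x)) // (le_trans (ler_norm _)) // /A addrAC lerDr addr_ge0.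
  - rewrite (le_trans (hA1 x)) // -sq ler_pM ?norm3_ge0 // /A -addrA lerDl addr_ge0 //.
  - exact: bu.
  - exact: bu1.
  - by rewrite -sq.
have Mx := not_cube cx.
apply: (@le_trans _ _ ((`|g00 * u0| * 32)%:E * (3 * 1 / reg 1 x ^+ 5)%:E)%E); last first.
  by rewrite leeDr // mule_ge0.
rewrite -EFinM lee_fin /smoothed -/g00 laplacian_vanish // g0 // !mul0r subrr sub0r normrN [leLHS]normrM -[leRHS]mulrA ler_wpM2l //.
have t0 := reg_gt0 ltr01 x.
rewrite ger0_norm; last by rewrite divr_ge0 ?exprn_ge0 ?mulr_ge0 // ltW.
have r1 : 1 <= norm3 x by rewrite (le_trans M1) // (le_trans (ltW Mx)) // norm_le_norm3.
have t2 := reg_sqr x ler01.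
have ts : reg 1 x <= 2 * reg e x by nra.
rewrite mulr1 (_ : 32 * _ = 3 / (reg 1 x / 2) ^+ 5); last by field; rewrite gt_eqF.
apply: (@le_trans _ _ (3 / reg e x ^+ 5)).
  by rewrite ler_wpM2r ?invr_ge0 ?exprn_ge0 ?(ltW s0) //; lra.
rewrite ler_wpM2l // lef_pV2 ?posrE ?exprn_gt0 ?divr_gt0 //.
by rewrite lerXn2r ?nnegrE ?divr_ge0 ?(ltW t0) ?(ltW s0) // ler_pdivrMr // mulrC.
Qed.

Lemma smoothed_cvg x : 0 < norm3 x -> smoothed n.+1%:R^-1 x @[n --> \oo] --> smoothed 0 x.
Proof.
move=> r0.
have rn : norm3 x != 0 by rewrite gt_eqF.
have ce : (n.+1%:R^-1 : R) @[n --> \oo] --> (0 : R) by exact: cvg_harmonic.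
have cs : reg n.+1%:R^-1 x @[n --> \oo] --> norm3 x.
  rewrite norm3_reg /reg; apply: continuous_cvg; first exact: sqrt_continuous.
  by apply: cvgD => //; exact: cvg_cst.
have cf (f : R -> R) : {for norm3 x, continuous f} -> f (reg n.+1%:R^-1 x) @[n --> \oo] --> f (norm3 x).
  by move=> cfx; apply: continuous_cvg.
have cv k : (reg n.+1%:R^-1 x ^+ k)^-1 @[n --> \oo] --> (norm3 x ^+ k)^-1.
  apply: (cf (fun t => (t ^+ k)^-1)).
  by apply: cvgV; [rewrite expf_neq0|exact: exprn_continuous].
have cu := cf _ (D_continuous (du r0)); have cu1 := cf _ (D_continuous (du1 r0)).
have cu2' := cf _ (cu2 r0).
have c3 : 3 * n.+1%:R^-1 @[n --> \oo] --> (3 * 0 : R) by apply: cvgM => //; exact: cvg_cst.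
rewrite /smoothed -norm3_reg; apply: cvgB; [apply: cvgB|].
- by apply: cvgM; [exact: cvg_cst|apply: cvgM => //; exact: (cv 1%N)].
- apply: cvgM; first exact: cvg_cst.
  apply: cvgB; [apply: cvgD|].
  + apply: cvgM; first by apply: cvgM => //; exact: (cv 1%N).
    by apply: cvgB; [exact: cvg_cst|exact: cvgM].
  + by apply: cvgM => //; exact: cvgM.
  + by apply: cvgM => //; exact: cvgM.
- by apply: cvgM; [exact: cvg_cst|exact: cvgM].
Qed.

Lemma smoothed0 x : smoothed 0 x = laplacian g x * (u (norm3 x) / norm3 x)
  - g x * (u2 (norm3 x) / norm3 x).
Proof. by rewrite /smoothed -norm3_reg !mulr0 !mul0r !(mulr0, subr0, addr0, mulr1). Qed.

Lemma lap_u_measurable :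
  measurable_fun setT ((fun x => laplacian g x * (u (norm3 x) / norm3 x)) : M3 -> R).
Proof.
apply: measurable_funM; first exact: (continuous3_measurable laplacian_continuous).
apply: (@radial_measurable (fun t => u t / t)) => [t t0|]; last by rewrite invr0 mulr0.
by apply: cvgM; [exact: D_continuous (du t0)|apply: cvgV; [rewrite gt_eqF|exact: cvg_id]].
Qed.

Lemma g_u2_measurable :
  measurable_fun setT ((fun x => g x * (u2 (norm3 x) / norm3 x)) : M3 -> R).
Proof.
apply: measurable_funM; first exact: (continuous3_measurable (sg [::]).1).
apply: (@radial_measurable (fun t => u2 t / t)) => [t t0|]; last by rewrite invr0 mulr0.
by apply: cvgM; [exact: cu2|apply: cvgV; [rewrite gt_eqF|exact: cvg_id]].
Qed.

(** Dominated convergence along e = 1 / (n + 1): the integrals do not depend on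
    e, and the integrands converge outside the origin. *)
Theorem radial_green :
  (\int[leb3]_x (laplacian g x * (u (norm3 x) / norm3 x)
     - g x * (u2 (norm3 x) / norm3 x))%:E = (- (4 * pi * u0 * g (0, 0, 0)))%:E)%E.
Proof.
have [K K0 hK] := smoothed_bound.
pose e n : R := n.+1%:R^-1.
have e0 n : 0 < e n by rewrite invr_gt0.
have e1 n : e n <= 1 by rewrite invf_le1 // ler1n.
pose G (x : M3) : \bar R := (K%:E * majorant M x
     + (`|g00 * u0| * 32)%:E * (3 * 1 / reg 1 x ^+ 5)%:E)%E.
have iG : leb3.-integrable setT G.
  apply: (@integrableD _ M3 R leb3 setT measurableT).
    by apply: (@integrableZl _ M3 R leb3 setT measurableT); exact: majorant_integrable.
  by apply: (@integrableZl _ M3 R leb3 setT measurableT); exact: mass_integrable.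
have [] := @dominated_convergence _ M3 R leb3 setT measurableT
  (fun n x => (smoothed (e n) x)%:E) (fun x => (smoothed 0 x)%:E) G.
- by move=> n; exact: measurable_int (smoothed_integral (e0 n)).1.
- apply/measurable_EFinP; rewrite (_ : smoothed 0 = (fun x => laplacian g x * (u (norm3 x) / norm3 x)
     - g x * (u2 (norm3 x) / norm3 x))); last by apply/funext => x; exact: smoothed0.
  by apply: measurable_funB; [exact: lap_u_measurable|exact: g_u2_measurable].
- apply: filterS ae_norm3_gt0 => x r0 _.
  by apply: cvg_EFin; [near=> n|exact: smoothed_cvg].
- exact: iG.
- by apply: aeW => x n _; rewrite /G; apply: hK; rewrite e0 e1.
move=> _ _ cI.
have : [sequence (\int[leb3]_(x in setT) (smoothed (e n) x)%:E)%E]_n @ \oo --> (- (4 * pi * u0 * g00))%:E.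
  rewrite (_ : [sequence _]_n = cst (- (4 * pi * u0 * g00))%:E); first exact: cvg_cst.
  by apply/funext => n; rewrite /= (smoothed_integral (e0 n)).2.
move=> /(cvg_unique _ cI) <- //; apply: eq_integral => x _.
by rewrite smoothed0.
Unshelve. all: by end_near. Qed.

End radial_green.
End radial.

(** * Entire power series and solutions with a logarithm *)

Section power_series.
Variable R : realType.
Implicit Types (a b : R^nat) (x s r : R).

(** Coefficients of exponential type; unlike convergence on the whole line,
    the bound is visibly stable under differentiation and shift. *)
Definition entire a : Prop := exists D K, 0 <= K /\ forall p, `|a p| <= D * (K ^+ p / p`!%:R).

Definition psum a x : R := limn (pseries a x).

Lemma entire_cvg a x : entire a -> cvgn (pseries a x).
Proof.
move=> [D [K [K0 aK]]]; apply: normed_cvg.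
have D0 : 0 <= D by have := le_trans (normr_ge0 _) (aK 0%N); rewrite expr0 fact0 divr1 mulr1.
apply: (@series_le_cvg _ _ (fun n => D * exp_coeff (K * `|x|) n)) => [n|n|n|].
- exact: normr_ge0.
- by rewrite /exp_coeff /= mulr_ge0 // divr_ge0 // exprn_ge0 // mulr_ge0.
- rewrite /exp_coeff /= normrM normrX exprMn [in leRHS]mulrAC mulrA.
  by rewrite ler_wpM2r ?exprn_ge0.
- have -> : series (fun n => D * exp_coeff (K * `|x|) n) =
      (fun n => D * series (exp_coeff (K * `|x|)) n).
    by apply/funext => n; rewrite /series /= mulr_sumr.
  apply/cvg_ex; exists (D * limn (series (exp_coeff (K * `|x|)))).
  by apply: cvgM; [exact: cvg_cst|exact: is_cvg_series_exp_coeff].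
Qed.

Lemma entire_shift a : entire a -> entire (fun p => a p.+1).
Proof.
move=> [D [K [K0 aK]]]; exists (D * K), K; split=> // p.
have D0 : 0 <= D by have := le_trans (normr_ge0 _) (aK 0%N); rewrite expr0 fact0 divr1 mulr1.
apply: le_trans (aK p.+1) _; rewrite exprS -!mulrA ler_wpM2l // ler_wpM2l //.
rewrite ler_wpM2l ?exprn_ge0 // lef_pV2 ?posrE ?ltr0n ?fact_gt0 // ler_nat.
by rewrite factS leq_pmull.
Qed.

Lemma entire_mulX a b : entire a -> b 0%N = 0 -> (forall p, b p.+1 = a p) -> entire b.
Proof.
move=> [D [K [K0 aK]]] b0 ba; exists D, (2 * (K + 1)).
have D0 : 0 <= D by have := le_trans (normr_ge0 _) (aK 0%N); rewrite expr0 fact0 divr1 mulr1.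
split=> [|p]; first by rewrite mulr_ge0 // addr_ge0.
case: p => [|p]; first by rewrite b0 normr0 expr0 fact0 divr1 mulr1.
rewrite ba (le_trans (aK p)) // ler_wpM2l //.
have fp : (0 : R) < p`!%:R by rewrite ltr0n fact_gt0.
have p0 : (0 : R) < p.+1%:R by rewrite ltr0n.
rewrite factS natrM ler_pdivrMr // invfM mulrA mulfVK ?gt_eqF // ler_pdivlMr // mulrC exprMn.
rewrite ler_pM ?exprn_ge0 //.
  by rewrite -natrX ler_nat ltnW // ltn_expl.
apply: (@le_trans _ _ ((K + 1) ^+ p)); first by rewrite lerXn2r ?nnegrE ?addr_ge0 // lerDl.
by rewrite ler_weXn2l // lerDr.
Qed.

Lemma entire_diffs a : entire a -> entire (pseries_diffs a).
Proof.
move=> [D [K [K0 aK]]]; exists (D * K), K; split=> // p.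
rewrite /pseries_diffs normrM ger0_norm //.
apply: le_trans (ler_wpM2l _ (aK p.+1)) _ => //.
rewrite factS natrM exprS le_eqVlt; apply/orP; left; apply/eqP.
have : (p.+1%:R : R) != 0 by rewrite pnatr_eq0.
have : (p`!%:R : R) != 0 by rewrite pnatr_eq0 -lt0n fact_gt0.
by move: (p.+1%:R) (p`!%:R) => u v v0 u0; field; rewrite v0.
Qed.

Lemma psum_deriv a x : entire a -> has_deriv (psum a) x (psum (pseries_diffs a) x).
Proof.
move=> ea; have ed := entire_diffs ea.
apply: (@pseries_snd_diffs _ a (`|x| + 1)); [exact: entire_cvg..|exact/entire_cvg/entire_diffs|].
by rewrite [ltRHS]ger0_norm ?addr_ge0 // ltrDl.
Qed.

Lemma psum_continuous a : entire a -> continuous (psum a).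
Proof. by move=> ea x; exact: D_continuous (psum_deriv x ea). Qed.

Lemma psum_lim a x l : series (fun p => a p * x ^+ p) @ \oo --> l -> psum a x = l.
Proof. by move=> h; apply/cvg_lim. Qed.

Lemma psum_cvg a x : entire a -> series (fun p => a p * x ^+ p) @ \oo --> psum a x.
Proof. exact: entire_cvg. Qed.

Lemma psum_linear a b c (al be ga : R) x : entire a -> entire b -> entire c ->
  psum (fun p => al * a p + be * b p + ga * c p) x =
  al * psum a x + be * psum b x + ga * psum c x.
Proof.
move=> /(psum_cvg (x := x)) ea /(psum_cvg (x := x)) eb /(psum_cvg (x := x)) ec; apply: psum_lim.
have -> : series (fun p => (al * a p + be * b p + ga * c p) * x ^+ p) =
  (fun n => al * series (fun p => a p * x ^+ p) n + be * series (fun p => b p * x ^+ p) n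
     + ga * series (fun p => c p * x ^+ p) n).
  apply/funext => n; rewrite /series /= !mulr_sumr -!big_split /=.
  by apply: eq_bigr => i _; ring.
by apply: cvgD; [apply: cvgD|]; (apply: cvgM => //; exact: cvg_cst).
Qed.

Lemma psum_mulX a b x : entire a -> b 0%N = 0 -> (forall p, b p.+1 = a p) ->
  psum b x = x * psum a x.
Proof.
move=> /(psum_cvg (x := x)) ea b0 ba; apply: psum_lim.
rewrite -(cvg_shiftS _).
have -> : (fun n => series (fun p => b p * x ^+ p) n.+1) =
    (fun n => x * series (fun p => a p * x ^+ p) n).
  apply/funext => n; rewrite /series /= big_nat_recl // b0 mul0r add0r mulr_sumr.
  by apply: eq_bigr => i _; rewrite ba exprS; ring.
by apply: cvgM => //; exact: cvg_cst.
Qed.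

Lemma psum_head a x : entire a -> psum a x = a 0%N + x * psum (fun p => a p.+1) x.
Proof.
move=> ea; have /(psum_cvg (x := x)) es := entire_shift ea; apply: psum_lim.
rewrite -(cvg_shiftS _).
have -> : (fun n => series (fun p => a p * x ^+ p) n.+1) =
    (fun n => a 0%N + x * series (fun p => a p.+1 * x ^+ p) n).
  apply/funext => n; rewrite /series /= big_nat_recl // expr0 mulr1 mulr_sumr.
  by congr (_ + _); apply: eq_bigr => i _; rewrite exprS; ring.
by apply: cvgD; [exact: cvg_cst|apply: cvgM => //; exact: cvg_cst].
Qed.

Lemma continuous_bounded (P : R -> R) (S : R) : continuous P ->
  exists2 C, 0 <= C & forall s, 0 < s <= S -> `|P s| <= C.
Proof.
move=> cP.
have /compact_bounded[C [_ hC]] : compact (P @` `[0, S]).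
  by apply: continuous_compact; [exact: continuous_subspaceT|exact: segment_compact].
exists `|C + 1| => // s /andP[s0 sS]; apply: le_trans (ler_norm _).
by apply: hC; [rewrite ltrDl|exists s => //=; rewrite in_itv /= (ltW s0)].
Qed.

(** From ln q <= q applied to the square root q of s and to 1 / q. *)
Lemma ln_bound s : 0 < s -> `|ln s| <= 2 * (s + 1) / Num.sqrt s.
Proof.
move=> s0; set q := Num.sqrt s.
have q0 : 0 < q by rewrite sqrtr_gt0.
have sq : s = q ^+ 2 by rewrite sqr_sqrtr // ltW.
have -> : ln s = 2 * ln q by rewrite sq lnXn // mulr_natl.
have l1 := ln_sublinear q0.
have l2 : - ln q < q^-1 by rewrite -lnV ?posrE // ln_sublinear ?invr_gt0.
have -> : 2 * (s + 1) / q = 2 * (q + q^-1) by rewrite sq; field; rewrite gt_eqF.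
have qV0 : 0 < q^-1 by rewrite invr_gt0.
by move: (q^-1) qV0 l2 => qi qi0 l2; rewrite ler_norml; apply/andP; split; lra.
Qed.

Section log_solution.
Variables a b : R^nat.
Hypotheses (ea : entire a) (eb : entire b).
Local Notation dif := pseries_diffs.

(** Solutions of Frobenius type at the regular singular point 0, whose exponents
    0 and 1 differ by an integer: hence the logarithm, carried by the solution
    s * psum b s that vanishes at 0. *)
Definition lsol s := psum a s + s * psum b s * ln s.
Definition lsol1 s := psum (dif a) s + psum b s + (psum b s + s * psum (dif b) s) * ln s.
Definition lsol2 s := psum (dif (dif a)) s + psum (dif b) s
  + (2 * psum (dif b) s + s * psum (dif (dif b)) s) * ln s + (psum b s + s * psum (dif b) s) / s.

Lemma lsol_deriv s : 0 < s -> has_deriv lsol s (lsol1 s).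
Proof.
move=> s0; apply: D_eq.
  apply: D_add; first exact: psum_deriv.
  apply: D_mul; last by apply: D_ln (D_id s).
  by apply: D_mul (D_id s) _; exact: psum_deriv.
by rewrite /lsol1 /=; field; rewrite gt_eqF.
Qed.

Lemma lsol1_deriv s : 0 < s -> has_deriv lsol1 s (lsol2 s).
Proof.
have ea' := entire_diffs ea; have eb' := entire_diffs eb.
move=> s0; apply: D_eq.
  apply: D_add; first by apply: D_add; exact: psum_deriv.
  apply: D_mul; last by apply: D_ln (D_id s).
  apply: D_add; first exact: psum_deriv.
  by apply: D_mul (D_id s) _; exact: psum_deriv.
by rewrite /lsol2 /=; field; rewrite gt_eqF.
Qed.

Let cid : continuous (fun s : R => s). Proof. by move=> s; exact: cvg_id. Qed.
Let ca' := psum_continuous (entire_diffs ea).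
Let ca'' := psum_continuous (entire_diffs (entire_diffs ea)).
Let cb := psum_continuous eb.
Let cb' := psum_continuous (entire_diffs eb).
Let cb'' := psum_continuous (entire_diffs (entire_diffs eb)).

Let cq1 : continuous (fun s => psum b s + s * psum (dif b) s).
Proof. by move=> s; apply: cvgD; [exact: cb|apply: cvgM; [exact: cid|exact: cb']]. Qed.

Let cq2 : continuous (fun s => 2 * psum (dif b) s + s * psum (dif (dif b)) s).
Proof.
move=> s; apply: cvgD; first by apply: cvgM; [exact: cvg_cst|exact: cb'].
by apply: cvgM; [exact: cid|exact: cb''].
Qed.

Let cp1 : continuous (fun s => psum (dif a) s + psum b s).
Proof. by move=> s; apply: cvgD; [exact: ca'|exact: cb]. Qed.

Let cp2 : continuous (fun s => psum (dif (dif a)) s + psum (dif b) s).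
Proof. by move=> s; apply: cvgD; [exact: ca''|exact: cb']. Qed.

Lemma lsol2_continuous s : 0 < s -> {for s, continuous lsol2}.
Proof.
move=> s0; apply: cvgD; [apply: cvgD|].
- exact: cp2.
- apply: cvgM; first exact: cq2.
  by apply: (D_continuous (a := 1 / s)); exact: D_ln (D_id s).
- by apply: cvgM; [exact: cq1|apply: cvgV; [rewrite gt_eqF|exact: cvg_id]].
Qed.

(** The power series are bounded on the interval and |ln s| is at most a
    multiple of 1 / sqrt s there. *)
Lemma lsol_bound S : 0 < S -> exists2 C, 0 <= C & forall s, 0 < s <= S ->
  [/\ `|lsol s - a 0%N| <= C * Num.sqrt s, `|lsol1 s| <= C / Num.sqrt s & `|lsol2 s| <= C / s].
Proof.
move=> S0.
have [A A0 hA] := continuous_bounded S (psum_continuous (entire_shift ea)).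
have [B B0 hB] := continuous_bounded S cb.
have [P1 P10 hP1] := continuous_bounded S cp1.
have [P2 P20 hP2] := continuous_bounded S cp2.
have [Q1 Q10 hQ1] := continuous_bounded S cq1.
have [Q2 Q20 hQ2] := continuous_bounded S cq2.
pose T := Num.sqrt S; pose L := 2 * (S + 1).
have T0 : 0 <= T by rewrite sqrtr_ge0.
have L0 : 0 <= L by rewrite mulr_ge0 // addr_ge0 // ltW.
pose C0 := A * T + B * L; pose C1 := P1 * T + Q1 * L; pose C2 := P2 * T ^+ 2 + Q2 * L * T + Q1.
have C00 : 0 <= C0 by apply: addr_ge0; apply: mulr_ge0.
have C10 : 0 <= C1 by apply: addr_ge0; apply: mulr_ge0.
have C20 : 0 <= C2.
  apply: addr_ge0 => //; apply: addr_ge0; first by apply: mulr_ge0 => //; exact: exprn_ge0.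
  by do 2 (apply: mulr_ge0 => //).
exists (C0 + C1 + C2); first by do 2!apply: addr_ge0 => //.
move=> s sS; have /andP[s0 sS'] := sS.
have {hA} := hA _ sS; have {hB} := hB _ sS; have {hP1} := hP1 _ sS; have {hP2} := hP2 _ sS.
have {hQ1} := hQ1 _ sS; have {hQ2} := hQ2 _ sS.
rewrite /lsol /lsol1 /lsol2 (psum_head s ea).
move: (psum b s + s * psum (dif b) s) (2 * psum (dif b) s + s * psum (dif (dif b)) s) => q1 q2.
move: (psum (dif a) s + psum b s) (psum (dif (dif a)) s + psum (dif b) s) => p1 p2.
move: (psum (fun p => a p.+1) s) (psum b s) => a1 b0 hq2 hq1 hp2 hp1 hb ha.
pose q := Num.sqrt s.
have q0 : 0 < q by rewrite sqrtr_gt0.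
have sq : s = q ^+ 2 by rewrite sqr_sqrtr // ltW.
have qT : q <= T by rewrite ler_wsqrtr.
have lnb : `|ln s| * q <= L.
  by rewrite -ler_pdivlMr // (le_trans (ln_bound s0)) // ler_wpM2r ?invr_ge0 ?(ltW q0) // /L; lra.
move: (ln s) lnb => l lnb; rewrite -/q.
split.
- have -> : a 0%N + s * a1 + s * b0 * l - a 0%N = (a1 * q + b0 * (l * q)) * q by rewrite sq; ring.
  rewrite normrM (gtr0_norm q0) ler_wpM2r ?(ltW q0) // (le_trans (ler_normD _ _)) //.
  apply: (@le_trans _ _ C0); last by lra.
  by rewrite lerD // normrM ?[`|l * q|]normrM ?(gtr0_norm q0) ler_pM ?mulr_ge0 ?(ltW q0).
- have -> : p1 + q1 * l = (p1 * q + q1 * (l * q)) / q by field; rewrite gt_eqF.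
  rewrite normrM normfV (gtr0_norm q0) ler_wpM2r ?invr_ge0 ?(ltW q0) // (le_trans (ler_normD _ _)) //.
  apply: (@le_trans _ _ C1); last by lra.
  by rewrite lerD // normrM ?[`|l * q|]normrM ?(gtr0_norm q0) ler_pM ?mulr_ge0 ?(ltW q0).
- have -> : p2 + q2 * l + q1 / s = (p2 * q ^+ 2 + q2 * (l * q) * q + q1) / s by rewrite sq; field; rewrite gt_eqF.
  rewrite normrM normfV (gtr0_norm s0) ler_wpM2r ?invr_ge0 ?(ltW s0) //.
  apply: (@le_trans _ _ C2); last by lra.
  rewrite (le_trans (ler_normD _ _)) // lerD // (le_trans (ler_normD _ _)) // lerD // !normrM ?normrX (gtr0_norm q0).
    by rewrite [T ^+ 2]expr2 !ler_pM ?mulr_ge0 ?(ltW q0).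
  apply: ler_pM => //; [by rewrite !mulr_ge0 // ltW|exact: ltW|].
  by apply: ler_pM => //; rewrite mulr_ge0 // ltW.
Qed.
End log_solution.

(** The complex equation u'' = c u / s with c = al + i be, read on real parts:
    (a, b) and (a', b') hold the coefficients of the real and imaginary parts
    of u. The terms with and without ln s match separately, and each match is
    one recurrence on the coefficients. *)
Lemma lsol_ode (al be : R) (a b a' b' : R^nat) :
  entire a -> entire b -> entire a' -> entire b' ->
  (forall p, p.+1%:R * p%:R * a p.+1 + (2 * p%:R + 1) * b p = al * a p - be * a' p) ->
  (forall p, p.+2%:R * p.+1%:R * b p.+1 = al * b p - be * b' p) ->
  forall s, 0 < s -> lsol2 a b s = (al * lsol a b s - be * lsol a' b' s) / s.
Proof.
move=> ea eb ea' eb' ra rb s s0.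
have sn : s != 0 by rewrite gt_eqF.
have da := entire_diffs ea; have db := entire_diffs eb.
have dda := entire_diffs da; have ddb := entire_diffs db.
have ez : entire (fun=> 0) by exists 0, 0; split=> // p; rewrite normr0 mul0r.
pose ta := (fun p : nat => p%:R * p.+1%:R * a p.+1).
pose tb := (fun p : nat => p%:R * b p).
pose tb2 := (fun p : nat => p%:R * p.+1%:R * b p.+1).
have Ea : psum ta s = s * psum (pseries_diffs (pseries_diffs a)) s.
  by apply: psum_mulX => // [|p]; rewrite /ta ?mul0r // /pseries_diffs mulrA.
have Eb : psum tb s = s * psum (pseries_diffs b) s.
  by apply: psum_mulX => //; rewrite /tb mul0r.
have Eb2 : psum tb2 s = s * psum (pseries_diffs (pseries_diffs b)) s.
  by apply: psum_mulX => // [|p]; rewrite /tb2 ?mul0r // /pseries_diffs mulrA.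
have eta : entire ta.
  by apply: (entire_mulX dda) => [|p]; rewrite /ta ?mul0r // /pseries_diffs mulrA.
have etb : entire tb by apply: (entire_mulX db) => //; rewrite /tb mul0r.
have etb2 : entire tb2.
  by apply: (entire_mulX ddb) => [|p]; rewrite /tb2 ?mul0r // /pseries_diffs mulrA.
have H1 : s * psum (pseries_diffs (pseries_diffs a)) s + 2 * (s * psum (pseries_diffs b) s) + psum b s
   = al * psum a s - be * psum a' s.
  rewrite -Ea -Eb.
  have := psum_linear 1 2 1 s eta etb eb.
  rewrite (_ : (fun p => _) = (fun p => al * a p + (- be) * a' p + 0 * a p)); last first.
    by apply/funext => p; rewrite mul0r addr0 mulNr -ra /ta /tb; ring.
  by rewrite psum_linear // mul0r addr0 mulNr !mul1r => ->.
have H2 : 2 * psum (pseries_diffs b) s + s * psum (pseries_diffs (pseries_diffs b)) s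
   = al * psum b s - be * psum b' s.
  rewrite -Eb2.
  have := psum_linear 2 1 0 s db etb2 eb.
  rewrite (_ : (fun p => _) = (fun p => al * b p + (- be) * b' p + 0 * b p)); last first.
    apply/funext => p; rewrite mul0r addr0 mulNr -rb /tb2 /pseries_diffs.
    by rewrite (natrD _ 2 p) (natrD _ 1 p); ring.
  by rewrite psum_linear // !mul0r !addr0 mulNr !mul1r => ->.
rewrite /lsol2 /lsol H2; apply: (mulIf sn); rewrite divfK //.
rewrite [LHS](_ : _ = (s * psum (pseries_diffs (pseries_diffs a)) s + 2 * (s * psum (pseries_diffs b) s) + psum b s)
   + s * (al * psum b s - be * psum b' s) * ln s); last by field.
by rewrite H1; ring.
Qed.
End power_series.

Local Open Scope complex_scope.

(** * The coefficients of the solution *)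

Section coefficients.
Variable R : realType.
Implicit Types (f : R^nat).

(** In the series for u the power r^(p+1) has the coefficient
    f (p+1) * wt p * (ln r - harm (p+1)), where f p is a component of
    (- 2 Z)^p. One factor r goes with the logarithm, which shifts [coefB] by one
    index. *)
Definition wt (p : nat) : R := ((p.+1)`!%:R * p`!%:R)^-1.
Definition harm (p : nat) : R := Hnum R p + Hnum R p.-1 - 1.

Definition coefB f (p : nat) : R := f p.+1 * wt p.
Definition coefA f (p : nat) : R := if p is q.+1 then - (f p * wt q * harm p) else f 0%N.

Lemma HnumS p : Hnum R p.+1 = Hnum R p + p.+1%:R^-1.
Proof. by rewrite /Hnum big_nat_recr. Qed.

Lemma Hnum0 : Hnum R 0 = 0.
Proof. by rewrite /Hnum big_geq. Qed.

Lemma Hnum_bound p : 0 <= Hnum R p <= p%:R.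
Proof.
elim: p => [|p /andP[h0 hp]]; first by rewrite Hnum0 lexx.
have p1 : (p.+1%:R^-1 : R) <= 1 by rewrite invf_le1 // ler1n.
have p0 : (0 : R) <= p.+1%:R^-1 by rewrite invr_ge0.
rewrite HnumS; move: (p.+1%:R^-1) p0 p1 => q p0 p1.
by rewrite (natrD _ 1 p); apply/andP; split; lra.
Qed.

Lemma harm1 : harm 1 = 0.
Proof. by rewrite /harm /= HnumS Hnum0 add0r invr1 addr0 subrr. Qed.

Lemma harmS p : harm p.+2 = harm p.+1 + p.+2%:R^-1 + p.+1%:R^-1.
Proof. by rewrite /harm /= !HnumS; ring. Qed.

Lemma wtS p : wt p = p.+2%:R * p.+1%:R * wt p.+1.
Proof.
rewrite /wt !factS !natrM.
have h n : (n.+1%:R : R) != 0 by rewrite pnatr_eq0.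
have fp : (p`!%:R : R) != 0 by rewrite pnatr_eq0 -lt0n fact_gt0.
have := h p; have := h p.+1; move: (p.+1%:R) (p.+2%:R) (p`!%:R) fp => u v w w0 v0 u0.
by field; rewrite ?u0 ?v0 ?w0.
Qed.

Lemma wt_bound p : 0 <= wt p <= (p.+1`!%:R)^-1.
Proof.
rewrite /wt invfM; have f1 : (1 : R) <= p`!%:R by rewrite ler1n fact_gt0.
rewrite mulr_ge0 ?invr_ge0 //= ler_piMr ?invr_ge0 //.
by rewrite invf_le1 // (lt_le_trans _ f1).
Qed.

Section growth.
Variables (f : R^nat) (K : R).
Hypotheses (K0 : 0 <= K) (fK : forall p, `|f p| <= K ^+ p).

Lemma coefB_entire : entire (coefB f).
Proof.
exists K, K; split=> // p; have /andP[w0 w1] := wt_bound p.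
rewrite /coefB normrM (ger0_norm w0).
apply: le_trans (ler_pM _ w0 (fK _) w1) _ => //.
rewrite exprS -mulrA ler_wpM2l // ler_wpM2l ?exprn_ge0 //.
rewrite lef_pV2 ?posrE ?ltr0n ?fact_gt0 // ler_nat.
by rewrite factS leq_pmull.
Qed.

Lemma coefA_entire : entire (coefA f).
Proof.
exists 2, (2 * K); split=> [|p]; first by rewrite mulr_ge0.
case: p => [|p]; first by rewrite /coefA !expr0 fact0 divr1 mulr1 (le_trans (fK 0)) // expr0; lra.
have /andP[w0 w1] := wt_bound p.
rewrite /coefA normrN !normrM (ger0_norm w0).
have hb : `|harm p.+1| <= 2 * 2 ^+ p.+1.
  have /andP[h0 h1] := Hnum_bound p.+1; have /andP[h2 h3] := Hnum_bound p.
  have : (p.+1%:R : R) <= 2 ^+ p.+1 by rewrite -natrX ler_nat ltnW // ltn_expl.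
  have : (1 : R) <= 2 ^+ p.+1 by rewrite exprn_ege1 //; lra.
  rewrite /harm /= in h0 h1 h2 h3 *; move: h3; rewrite (natrD _ 1 p); move: h1; rewrite (natrD _ 1 p).
  move: (2 ^+ p.+1) (p%:R) (Hnum R p.+1) (Hnum R p) h0 h2 => A B C D h0 h2 h1 h3 A1 BA.
  by rewrite ler_norml; apply/andP; split; lra.
apply: le_trans (ler_pM _ _ (ler_pM _ w0 (fK _) w1) hb) _ => //; first by rewrite mulr_ge0.
by rewrite exprMn le_eqVlt; apply/orP; left; apply/eqP; ring.
Qed.
End growth.

Section recurrence.
Variables (al be : R) (f f' : R^nat).
Hypothesis rec : forall p, f p.+1 = al * f p - be * f' p.

Lemma coefB_rec p : p.+2%:R * p.+1%:R * coefB f p.+1 = al * coefB f p - be * coefB f' p.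
Proof. by rewrite /coefB rec (wtS p); ring. Qed.

Lemma coefA_rec p : p.+1%:R * p%:R * coefA f p.+1 + (2 * p%:R + 1) * coefB f p =
  al * coefA f p - be * coefA f' p.
Proof.
case: p => [|p].
  by rewrite /coefA /coefB /wt fact0 rec !(mulr0, mul0r, add0r) mulr1 invr1 mulr1 mul1r.
rewrite /coefA /coefB rec harmS (wtS p) (natrD _ 1 p.+1) (natrD _ 1 p).
have h1 : (1 + p%:R : R) != 0 by rewrite -(natrD _ 1 p) pnatr_eq0.
have h2 : (1 + (1 + p%:R) : R) != 0 by rewrite -!(natrD _ 1) pnatr_eq0.
by field; rewrite h1 h2.
Qed.
End recurrence.
End coefficients.

Section words.
Variable R : realType.
Local Notation C := R[i].

Lemma word_coef0 (Z : C) a : (0 < count_mem 2 a)%N -> word_coef Z 0 a = 0.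
Proof. by rewrite /word_coef expr0n /= expr0n => /gtn_eqF ->; rewrite mulr0. Qed.

(** Every word ending in 2 contains the factor kappa^2. *)
Lemma sum_words2 (Z : C) p (F : seq nat -> C) :
  \sum_(a <- append_letter 2 (S_ p)) word_coef Z 0 a * F a = 0.
Proof.
rewrite big_map big1 // => a _.
by rewrite word_coef0 ?mul0r // -cats1 count_cat /= addn1.
Qed.

Lemma S_ones p a : a \in S_ p -> (count_mem 2 a == 0)%N -> a = nseq p 1%N.
Proof.
rewrite mem_S => /andP[/allP a12 /eqP <-] c2.
have a1 : all (pred1 1%N) a.
  apply/allP => l la; have := a12 _ la; rewrite !inE => /orP[//|/eqP l2].
  by move/eqP/count_memPn: c2; rewrite -l2 la.
have -> : sumn a = size a by elim: a a1 {a12 c2} => //= l a IH /andP[/eqP -> /IH ->].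
exact/all_pred1P.
Qed.

Lemma mem_S_ones p : nseq p 1%N \in S_ p.
Proof.
rewrite mem_S sumn_nseq mul1n eqxx andbT.
by apply/allP => l; rewrite mem_nseq => /andP[_ /eqP ->].
Qed.

Lemma sum_words1 (Z : C) p (F : seq nat -> C) :
  \sum_(a <- append_letter 1 (S_ p)) word_coef Z 0 a * F a =
  (- 2 * Z) ^+ p.+1 * F (nseq p.+1 1%N).
Proof.
have rc q : rcons (nseq q 1%N) 1%N = nseq q.+1 1%N by elim: q => //= q ->.
rewrite big_map (bigD1_seq (nseq p 1%N)) ?mem_S_ones ?uniq_S //= big_seq_cond big1.
  rewrite addr0 rc /word_coef !count_nseq size_nseq /= mul1n mul0n expr0 mulr1.
  by rewrite -!exprMn mulN1r mulNr.
move=> a /andP[aS an]; rewrite word_coef0 ?mul0r // lt0n; apply: contra an.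
rewrite -cats1 count_cat /= !addn0 => c2.
by apply/eqP; apply: S_ones aS c2.
Qed.

Lemma rest_ones p j : (j <= p)%N -> rest p (nseq p 1%N) j = (p - j)%N.
Proof.
move=> jp; rewrite /rest -{2}(subnKC jp) nseqD take_size_cat ?size_nseq //.
by rewrite sumn_nseq mul1n.
Qed.

(** Induction on the number m of factors taken: the factors left out make
    up the weight wt (q - m). *)
Lemma word_prod_ones q :
  word_prod R q.+1 (nseq q.+1 1%N) q = (wt R q)%:C.
Proof.
have H (m : nat) : (m <= q)%N -> \prod_(0 <= j < m) ((rest q.+1 (nseq q.+1 1%N) j)%:R
    * ((rest q.+1 (nseq q.+1 1%N) j)%:R - 1))^-1 * (wt R (q - m))%:C = (wt R q)%:C :> C.
  elim: m => [|m IH] mq; first by rewrite big_geq // mul1r subn0.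
  rewrite big_nat_recr //= -(IH (ltnW mq)) -mulrA; congr (_ * _).
  have := subSS m q; rewrite -(subnSK mq) => e.
  rewrite rest_ones; last exact: leq_trans (ltnW mq) _.
  rewrite subSn ?(ltnW mq) // -(subnSK mq) (wtS _ (q - m.+1)%N).
  move: (q - m.+1)%N => d; rewrite -(natrB _ (ltn0Sn _)) subn1 /=.
  rewrite rmorphM rmorphM !rmorph_nat mulrA mulVf ?mul1r //.
by have := H q (leqnn q); rewrite subnn /word_prod /wt !fact0 => <-; rewrite !mulr1 invr1 mulr1.
Qed.

Lemma word_harm_ones q :
  word_harm R q.+1 (nseq q.+1 1%N) q = (harm R q.+1)%:C.
Proof.
have H (m : nat) : (m <= q)%N -> \sum_(0 <= j < m) (((rest q.+1 (nseq q.+1 1%N) j)%:R - 1)^-1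
    + (rest q.+1 (nseq q.+1 1%N) j)%:R^-1) + (harm R (q - m).+1)%:C = (harm R q.+1)%:C :> C.
  elim: m => [|m IH] mq; first by rewrite big_geq // add0r subn0.
  rewrite big_nat_recr //= -(IH (ltnW mq)) -addrA; congr (_ + _).
  rewrite rest_ones; last exact: leq_trans (ltnW mq) _.
  rewrite subSn ?(ltnW mq) // -(subnSK mq) harmS.
  move: (q - m.+1)%N => d; rewrite -(natrB _ (ltn0Sn _)) subn1 /=.
  by rewrite !rmorphD !fmorphV !rmorph_nat /=; ring.
by have := H q (leqnn q); rewrite subnn harm1 addr0.
Qed.

(** Only the word 1...1 contributes; the formula includes the separately defined
    case p = 1, where the harmonic term vanishes. *)
Lemma k_closed (Z : C) q r : 0 < r ->
  k_ Z 0 q.+1 r = - ((4 * pi * r)^-1)%:C * ((- 2 * Z) ^+ q.+1 * (wt R q)%:C * (ln r - harm R q.+1)%:C).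
Proof.
move=> r0; case: q => [|q].
  by rewrite /k_ harm1 subr0 /wt !fact0 mulr1 invr1 mulr1 expr1; ring.
rewrite [LHS]/k_ !subSS !subn0.
rewrite (sum_words2 Z q (fun a => word_prod R q.+2 a (size a))) mulr0 sub0r.
under eq_bigr do rewrite -mulrA.
rewrite (sum_words1 Z q.+1 (fun a => word_prod R q.+2 a (size a - 1) * ((ln r)%:C - word_harm R q.+2 a (size a - 1)))).
rewrite size_nseq subSS subn0 word_prod_ones word_harm_ones.
by rewrite [(ln r - _)%:C]rmorphB !mulrA !mulNr.
Qed.
End words.

(** * The closed form of the kernel *)

Section closed_form.
Variable R : realType.
Local Notation C := R[i].
Variable Z : C.

Let c : C := - 2 * Z.
Let al := complex.Re c.
Let be := complex.Im c.

Definition powRe (p : nat) : R := complex.Re (c ^+ p).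
Definition powIm (p : nat) : R := complex.Im (c ^+ p).

Lemma powReS p : powRe p.+1 = al * powRe p - be * powIm p.
Proof. by rewrite /powRe /powIm /al /be exprS; case: c (c ^+ p) => [? ?] [? ?]. Qed.

Lemma powImS p : powIm p.+1 = al * powIm p - (- be) * powRe p.
Proof.
rewrite /powRe /powIm /al /be exprS; case: c (c ^+ p) => [? ?] [? ?] /=.
by rewrite mulNr opprK.
Qed.

Definition powK : R := `|al| + `|be|.

Lemma powK_ge0 : 0 <= powK. Proof. by rewrite addr_ge0. Qed.

Lemma pow_bound p : `|powRe p| <= powK ^+ p /\ `|powIm p| <= powK ^+ p.
Proof.
rewrite /powK.
elim: p => [|p [h1 h2]]; first by rewrite /powRe /powIm !expr0 /= normr1 normr0.
rewrite powReS powImS exprS mulrDl; split; rewrite (le_trans (ler_normB _ _)) // !normrM ?normrN;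
  by rewrite lerD // ler_wpM2l.
Qed.

(** Real and imaginary parts of u, where kA Z 0 r = - u(r) / (4 pi r). *)
Definition solRe : R -> R := lsol (coefA powRe) (coefB powRe).
Definition solIm : R -> R := lsol (coefA powIm) (coefB powIm).

Let eAR : entire (coefA powRe) := coefA_entire powK_ge0 (fun p => (pow_bound p).1).
Let eBR : entire (coefB powRe) := coefB_entire powK_ge0 (fun p => (pow_bound p).1).
Let eAI : entire (coefA powIm) := coefA_entire powK_ge0 (fun p => (pow_bound p).2).
Let eBI : entire (coefB powIm) := coefB_entire powK_ge0 (fun p => (pow_bound p).2).

Lemma solRe_ode s : 0 < s ->
  lsol2 (coefA powRe) (coefB powRe) s = (al * solRe s - be * solIm s) / s.
Proof.
by apply: lsol_ode => // p; [exact: (coefA_rec powReS)|exact: (coefB_rec powReS)].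
Qed.

Lemma solIm_ode s : 0 < s ->
  lsol2 (coefA powIm) (coefB powIm) s = (al * solIm s + be * solRe s) / s.
Proof.
move=> s0; rewrite -[be in RHS]opprK mulNr.
by move: s0; apply: lsol_ode => // p; [exact: (coefA_rec powImS)|exact: (coefB_rec powImS)].
Qed.

(** The second sum stops one index earlier: the coefficient p of the series
    attached to r ln r belongs to the power r^(p+1), so that both parts of a term
    of the kernel's series enter at the same step. *)
Definition sol_partial (f : R^nat) (r : R) (n : nat) : R :=
  series (fun p => coefA f p * r ^+ p) n + r * ln r * series (fun p => coefB f p * r ^+ p) n.-1.

Lemma sol_partial_cvg f r : entire (coefA f) -> entire (coefB f) ->
  sol_partial f r n @[n --> \oo] --> lsol (coefA f) (coefB f) r.
Proof.
move=> eA eB; rewrite /lsol mulrAC; apply: cvgD; first exact: psum_cvg.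
apply: cvgM; first exact: cvg_cst.
by rewrite -(cvg_shiftS _) /=; exact: psum_cvg.
Qed.

Lemma sol_partialS f r q : sol_partial f r q.+2 =
  sol_partial f r q.+1 + r ^+ q.+1 * f q.+1 * wt R q * (ln r - harm R q.+1).
Proof.
rewrite /sol_partial /series /= (big_nat_recr q.+1) //=.
rewrite (@big_nat_recr _ _ _ q 0 (fun k => coefB f k * r ^+ k)) //=.
by rewrite /coefB [r ^+ q.+1]exprS; ring.
Qed.

(** In the modulus norm, from |x + i y| <= |x| + |y|. *)
Lemma cvg_complex (f g : R^nat) (a b : R) : f @ \oo --> a -> g @ \oo --> b ->
  (fun n => (f n +i* g n : C^o)) @ \oo --> (a +i* b : C^o).
Proof.
move=> cf cg; apply/cvgrPdist_lt => -[e e'] e0.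
have [{}e0 e'0] : 0 < e /\ e' = 0 by move: e0; rewrite ltcE /= => /andP[/eqP -> ->].
rewrite e'0; near=> n.
have h1 : `|a - f n| < e / 2 by near: n; move/cvgrPdist_lt: cf; apply; rewrite divr_gt0.
have h2 : `|b - g n| < e / 2 by near: n; move/cvgrPdist_lt: cg; apply; rewrite divr_gt0.
have -> : (a +i* b) - (f n +i* g n) = (a - f n)%:C + 'i * (b - g n)%:C :> C.
  by apply/eqP; rewrite eq_complex /=; apply/andP; split; apply/eqP; ring.
rewrite (le_lt_trans (ler_normD _ _)) // normrM normCi mul1r !normc_def /= !expr0n /= !addr0 !sqrtr_sqr.
by rewrite -rmorphD ltcR; lra.
Unshelve. all: by end_near. Qed.

Lemma kA_term r q : 0 < r -> r%:C ^+ q.+1 * k_ Z 0 q.+1 r =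
  (- (4 * pi * r)^-1 * (r ^+ q.+1 * powRe q.+1 * wt R q * (ln r - harm R q.+1))) +i*
  (- (4 * pi * r)^-1 * (r ^+ q.+1 * powIm q.+1 * wt R q * (ln r - harm R q.+1))).
Proof.
move=> r0; rewrite k_closed // -/c /powRe /powIm.
rewrite -rmorphXn; case: (c ^+ q.+1) => x y /=.
by apply/eqP; rewrite eq_complex /=; apply/andP; split; apply/eqP; ring.
Qed.

Lemma kA_series_partial r n : 0 < r -> kA_series Z 0 r n.+1 =
  (- (4 * pi * r)^-1 * sol_partial powRe r n.+1) +i*
  (- (4 * pi * r)^-1 * sol_partial powIm r n.+1).
Proof.
move=> r0; elim: n => [|n IH].
  rewrite /kA_series /sol_partial /series /= !big_nat1 !big_geq //= /powRe /powIm !expr0 /=.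
  rewrite mul1r; apply/eqP; rewrite eq_complex /=.
  by apply/andP; split; apply/eqP; ring.
rewrite /kA_series /series /= big_nat_recr //= -[X in X + _]/(kA_series Z 0 r n.+1) IH kA_term // !sol_partialS.
by apply/eqP; rewrite eq_complex /=; apply/andP; split; apply/eqP; ring.
Qed.

Lemma tail_partial r n : 0 < r -> kA0_tail Z r n.+2 =
  (sol_partial powRe r n.+2 - (1 + al * (r * ln r))) +i*
  (sol_partial powIm r n.+2 - be * (r * ln r)).
Proof.
move=> r0; elim: n => [|n IH].
  rewrite /kA0_tail big_geq // !sol_partialS harm1 subr0 /wt !fact0 mulr1 invr1.
  rewrite /sol_partial /series /= !big_nat1 !big_geq //= !powReS !powImS /powRe /powIm !expr0 /=.
  by apply/eqP; rewrite eq_complex /=; apply/andP; split; apply/eqP; ring.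
rewrite /kA0_tail big_nat_recr //= -[X in X + _]/(kA0_tail Z r n.+2) IH [in RHS]sol_partialS [sol_partial powIm _ _ in RHS]sol_partialS.
have -> : (-1) ^+ n.+2 * 2 ^+ n.+2 * Z ^+ n.+2 = c ^+ n.+2 by rewrite -!exprMn mulN1r.
have -> : (((n.+2)`!)%:R * ((n.+2.-1)`!)%:R)^-1 = (wt R n.+1)%:C.
  by rewrite /wt fmorphV rmorphM !rmorph_nat.
rewrite -rmorphXn -/(harm R n.+2) /powRe /powIm; case: (c ^+ n.+2) => x y /=.
by apply/eqP; rewrite eq_complex /=; apply/andP; split; apply/eqP; ring.
Qed.

Lemma kA_series_cvg r : 0 < r -> kA_series Z 0 r @ \oo -->
  ((- (4 * pi * r)^-1 * solRe r) +i* (- (4 * pi * r)^-1 * solIm r) : C^o).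
Proof.
move=> r0; rewrite -(cvg_shiftS _).
rewrite (_ : (fun n => _) = (fun n => ((- (4 * pi * r)^-1 * sol_partial powRe r n.+1) +i*
  (- (4 * pi * r)^-1 * sol_partial powIm r n.+1) : C^o))); last first.
  by apply/funext => n; exact: kA_series_partial.
by apply: cvg_complex; (apply: cvgM; [exact: cvg_cst|
  rewrite (cvg_shiftS (sol_partial _ r)); exact: sol_partial_cvg]).
Qed.

Lemma tail_cvg r : 0 < r -> kA0_tail Z r @ \oo -->
  ((solRe r - (1 + al * (r * ln r))) +i* (solIm r - be * (r * ln r)) : C^o).
Proof.
move=> r0; rewrite -(cvg_shiftS _) -(cvg_shiftS _).
rewrite (_ : (fun n => _) = (fun n => ((sol_partial powRe r n.+2 - (1 + al * (r * ln r))) +i*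
  (sol_partial powIm r n.+2 - be * (r * ln r)) : C^o))); last first.
  by apply/funext => n; exact: tail_partial.
by apply: cvg_complex; (apply: cvgB; [
  rewrite (cvg_shiftS (fun n => sol_partial _ r n.+1)) (cvg_shiftS (sol_partial _ r)); exact: sol_partial_cvg|exact: cvg_cst]).
Qed.

Lemma lim_complex (f : nat -> C^o) (l : C^o) : f @ \oo --> l -> limn f = l.
Proof. by move=> h; apply/cvg_lim => //; exact: norm_hausdorff. Qed.

Lemma kA_closed r : 0 < r ->
  [/\ cvgn (kA_series Z 0 r), cvgn (kA0_tail Z r) &
    kA Z 0 r = - ((4 * pi * r)^-1)%:C *
      (1 - 2 * Z * (r * ln r)%:C + limn (kA0_tail Z r))].
Proof.
move=> r0; split; [by apply/cvg_ex; eexists; exact: kA_series_cvg|by apply/cvg_ex; eexists; exact: tail_cvg|].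
rewrite /kA (lim_complex (kA_series_cvg r0)) (lim_complex (tail_cvg r0)).
have -> : 1 - 2 * Z * (r * ln r)%:C = 1 + c * (r * ln r)%:C by rewrite /c; ring.
rewrite /al /be; case: c => x y.
by apply/eqP; rewrite eq_complex /=; apply/andP; split; apply/eqP; ring.
Qed.

(** At r = 0 both sides are 0, as 1 / 0 = 0 makes every term of the series
    vanish. *)
Lemma kA_split r : 0 <= r -> kA Z 0 r =
  (- (4 * pi)^-1 * (solRe r / r)) +i* (- (4 * pi)^-1 * (solIm r / r)).
Proof.
rewrite le_eqVlt => /predU1P[<-|r0].
  have -> : kA Z 0 0 = 0.
    rewrite /kA (_ : kA_series Z 0 0 = fun=> 0); first by apply: lim_complex; exact: cvg_cst.
    apply/funext => n; rewrite /kA_series /series /= big1 // => p _.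
    have -> : k_ Z 0 p (0 : R) = 0; last by rewrite mulr0.
    by rewrite /k_ mulr0 invr0; case: p => [|[|p]]; rewrite ?oppr0 ?mul0r ?subr0 // ?mulNr ?mul0r ?oppr0 ?subr0.
  by rewrite invr0 !mulr0.
rewrite /kA (lim_complex (kA_series_cvg r0)) invfM.
by congr (_ +i* _); rewrite -mulNr; ring.
Qed.
End closed_form.

(** * Fundamental solutions *)

Section pairing.
Variable R : realType.
Local Notation E3 := (R * R * R)%type.
Local Notation MR := (measurableTypeR R).
Local Notation M3 := (measurableTypeR R * measurableTypeR R * measurableTypeR R)%type.
Local Notation leb3 := (@leb3 R).
Variables a b : R^nat.
Hypotheses (ea : entire a) (eb : entire b).

(** A crude bound, enough for local integrability: it makes the kernel and its
    pairing with a test function of order r^(-2). *)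
Lemma lsol_singular_bound (M : R) : 0 < M -> exists B, forall t, 0 < t -> t ^+ 2 <= 3 * M ^+ 2 ->
  `|lsol a b t| <= B / t /\ `|lsol2 a b t| <= B / t.
Proof.
move=> M0; pose S := 3 * M + 1.
have S0 : 0 < S by rewrite addr_gt0 // mulr_gt0.
have [C C0 hC] := lsol_bound ea eb S0.
have T0 : 0 <= Num.sqrt S by rewrite sqrtr_ge0.
exists ((`|a 0%N| + C * Num.sqrt S) * S + C) => t t0 t2.
have tS : t <= S by rewrite /S; nra.
have [|h1 _ h3] := hC t; first by rewrite t0.
split.
  rewrite ler_pdivlMr // (le_trans _ (_ : (`|a 0%N| + C * Num.sqrt S) * S <= _)) ?lerDl //.
  rewrite ler_pM ?(ltW t0) // -(subrK (a 0%N) (lsol a b t)) (le_trans (ler_normD _ _)) //.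
  by rewrite addrC lerD2l (le_trans h1) // ler_wpM2l // ler_wsqrtr.
rewrite (le_trans h3) // ler_wpM2r ?invr_ge0 ?(ltW t0) // lerDr.
by rewrite mulr_ge0 ?(ltW S0) // addr_ge0 // mulr_ge0.
Qed.

Definition green_density (g : E3 -> R) (x : E3) : R :=
  laplacian g x * (lsol a b (norm3 x) / norm3 x) - g x * (lsol2 a b (norm3 x) / norm3 x).

Variables (g : E3 -> R) (M : R).
Hypothesis M1 : 1 <= M.
Hypothesis sg : smooth g.
Hypothesis g0 : forall x, M < `|x| -> g x = 0.

Lemma green_density_integrable :
  leb3.-integrable setT (EFin \o green_density g : M3 -> \bar R).
Proof.
have M0 : 0 < M by exact: lt_le_trans M1.
have [B hB] := lsol_singular_bound M0.
have cL := laplacian_continuous sg.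
have [A1 hA1] := bounded_of_support cL (laplacian_vanish g0).
have [A2 hA2] := bounded_of_support (sg [::]).1 g0.
have i1 : leb3.-integrable setT (EFin \o (fun x => laplacian g x * (lsol a b (norm3 x) / norm3 x)) : M3 -> \bar R).
  apply: (@radial_integrable _ (laplacian g) (lsol a b) M A1 B) => //.
  - exact: continuous3_measurable.
  - by move=> x /not_cube; exact: laplacian_vanish.
  - by move=> t t0; exact: D_continuous (lsol_deriv ea eb t0).
  - by move=> t t0 t2; exact: (hB t t0 t2).1.
have i2 : leb3.-integrable setT (EFin \o (fun x => g x * (lsol2 a b (norm3 x) / norm3 x)) : M3 -> \bar R).
  apply: (@radial_integrable _ g (lsol2 a b) M A2 B) => //.
  - exact: continuous3_measurable (sg [::]).1.
  - by move=> x /not_cube; exact: g0.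
  - by move=> t t0; exact: lsol2_continuous.
  - by move=> t t0 t2; exact: (hB t t0 t2).2.
have := @integrableB _ M3 R leb3 setT measurableT _ _ i1 i2.
by apply: eq_integrable => // x _; rewrite /= EFinB.
Qed.

Lemma green_density_integral :
  \int[leb3]_(x in setT) green_density g x = - (4 * pi * a 0%N * g (0, 0, 0)).
Proof.
rewrite /Rintegral (@radial_green _ _ _ _ _ (fun s => lsol_deriv ea eb (s := s))
  (fun s => lsol1_deriv ea eb (s := s)) (fun s => lsol2_continuous ea eb (s := s))
  (fun S => lsol_bound ea eb (S := S)) g M M1 sg g0) //.
Qed.
End pairing.

Section fundamental.
Variable R : realType.
Local Notation C := R[i].
Local Notation E3 := (R * R * R)%type.
Local Notation MR := (measurableTypeR R).
Local Notation M3 := (measurableTypeR R * measurableTypeR R * measurableTypeR R)%type.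
Local Notation leb3 := (@leb3 R).
Variable Z : C.

Let eAR : entire (coefA (powRe Z)) := coefA_entire (powK_ge0 Z) (fun p => (pow_bound Z p).1).
Let eBR : entire (coefB (powRe Z)) := coefB_entire (powK_ge0 Z) (fun p => (pow_bound Z p).1).
Let eAI : entire (coefA (powIm Z)) := coefA_entire (powK_ge0 Z) (fun p => (pow_bound Z p).2).
Let eBI : entire (coefB (powIm Z)) := coefB_entire (powK_ge0 Z) (fun p => (pow_bound Z p).2).

Let ka : R := - (4 * pi)^-1.

(** The indicator of K plays the role of the bounded factor of
    [radial_integrable]. *)
Lemma lsol_locally_integrable (a b : R^nat) (K : set E3) : entire a -> entire b -> compact K ->
  leb3.-integrable (K : set M3) (EFin \o (fun x => ka * (lsol a b (norm3 x) / norm3 x)) : M3 -> \bar R).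
Proof.
move=> ea eb cK.
have mK := compact3_measurable cK.
have [M M0 KM] : exists2 M, 0 < M & K `<=` cube M.
  have [N [_ hN]] := compact_bounded cK.
  exists (`|N| + 1); first by rewrite ltr_wpDl.
  by move=> x Kx; apply/cubeP; apply: hN Kx; rewrite (le_lt_trans (ler_norm N)) // ltrDl.
have [B hB] := lsol_singular_bound ea eb M0.
apply/(@integrable_mkcond _ M3 R leb3 K _ mK).
have h : leb3.-integrable setT (EFin \o (fun x => (ka * \1_K x) * (lsol a b (norm3 x) / norm3 x)) : M3 -> \bar R).
  apply: (@radial_integrable _ (fun x => ka * \1_K x) (lsol a b) M `|ka| B) => //.
  - by apply: measurable_funM => //; exact: measurable_indic.
  - by move=> x; rewrite normrM ler_piMr // indicE; case: (x \in K); rewrite /= ?normr1 ?normr0.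
  - move=> x cx; rewrite indicE memNset ?mulr0 // => Kx; exact: cx (KM _ Kx).
  - by move=> t t0; exact: D_continuous (lsol_deriv ea eb t0).
  - by move=> t t0 t2; exact: (hB t t0 t2).1.
apply: eq_integrable h => // x _; rewrite /= patchE indicE.
by case: (x \in K); rewrite /= ?mulr1 // mulr0 mul0r.
Qed.

Lemma kA_locally_integrable : locally_integrable3 (fun x : E3 => kA Z 0 (norm3 x)).
Proof.
move=> K cK; split.
  have := lsol_locally_integrable eAR eBR cK.
  by apply: eq_integrable => [|x _]; [exact: compact3_measurable|rewrite /reC /= kA_split ?norm3_ge0].
have := lsol_locally_integrable eAI eBI cK.
by apply: eq_integrable => [|x _]; [exact: compact3_measurable|rewrite /imC /= kA_split ?norm3_ge0].
Qed.

Lemma kH_locally_integrable : locally_integrable3 (fun x : E3 => kH Z (norm3 x)).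
Proof.
move=> K cK; have mK := compact3_measurable cK; have [h1 h2] := kA_locally_integrable cK.
have E (x : E3) : kH Z (norm3 x) = (- 2)%:C * kA Z 0 (norm3 x) by rewrite /kH rmorphN rmorph_nat.
split.
  have := @integrableZl _ M3 R leb3 K mK (- 2) _ h1.
  apply: eq_integrable => // x _; rewrite /reC /= E -EFinM; case: (kA _ _ _) => u v /=.
  by congr EFin; ring.
have := @integrableZl _ M3 R leb3 K mK (- 2) _ h2.
apply: eq_integrable => // x _; rewrite /imC /= E -EFinM; case: (kA _ _ _) => u v /=.
by congr EFin; ring.
Qed.

Lemma test_support (g : E3 -> C) : compact (closure [set x : E3 | g x != 0]) ->
  exists2 M, 1 <= M & forall x, M < `|x| -> g x = 0.
Proof.
move=> /compact_bounded[N [_ hN]]; exists (`|N| + 1); first by rewrite lerDr.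
move=> x Mx; apply/eqP; apply: contraTT Mx => gx; rewrite -leNgt.
apply: hN; first by rewrite (le_lt_trans (ler_norm N)) // ltrDl.
exact: subset_closure.
Qed.

Let DR := green_density (coefA (powRe Z)) (coefB (powRe Z)).
Let DI := green_density (coefA (powIm Z)) (coefB (powIm Z)).

(** The potential terms are absorbed by the differential equation: 2 Z u / r is
    replaced by - u'', and what is left is a combination of real densities
    to which [radial_green] applies. *)
Lemma opA_kA (g : E3 -> C) x : opA Z 0 g x * kA Z 0 (norm3 x) =
  (ka * (DR (reC g) x - DI (imC g) x)) +i* (ka * (DI (reC g) x + DR (imC g) x)).
Proof.
rewrite kA_split ?norm3_ge0 // -/ka /DR /DI /green_density -/(solRe Z _) -/(solIm Z _).
have := norm3_ge0 x; rewrite le_eqVlt => /predU1P[<-|r0].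
  (* At the origin both sides are 0, because 1 / 0 = 0. *)
  have z (t : R) : t / 0 = 0 by rewrite invr0 mulr0.
  rewrite !z; move: (opA Z 0 g x) (laplacian _ x) (laplacian _ x) (reC g x) (imC g x) ka.
  clear=> -[A B] l1 l2 g1 g2 c; apply/eqP; rewrite eq_complex /=.
  by apply/andP; split; apply/eqP; ring.
rewrite solRe_ode // solIm_ode // /opA expr0n /= mulr0 mul0r subr0 /claplacian.
have rn : norm3 x != 0 by rewrite gt_eqF.
have -> : 2 * Z / (norm3 x)%:C = - ((norm3 x)^-1)%:C * (- 2 * Z).
  by rewrite fmorphV; ring.
move: (laplacian (reC g) x) (laplacian (imC g) x) (solRe Z (norm3 x)) (solIm Z (norm3 x)) => l1 l2 s1 s2.
rewrite /reC /imC; case: (- 2 * Z) (g x) => al be [g1 g2] /=.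
set r := norm3 x in rn *; move: r rn ka; clear=> r rn c.
by apply/eqP; rewrite eq_complex /=; apply/andP; split; apply/eqP; field.
Qed.

Lemma opA_fundamental (g : E3 -> C) : test_function g ->
  cintegrable setT (fun x => opA Z 0 g x * kA Z 0 (norm3 x)) /\
  Pf (fun x => kA Z 0 (norm3 x)) (opA Z 0 g) = delta0 g.
Proof.
move=> [s1 s2 /test_support[M M1 g0]].
have g10 x : M < `|x| -> reC g x = 0 by move=> /g0; rewrite /reC => ->.
have g20 x : M < `|x| -> imC g x = 0 by move=> /g0; rewrite /imC => ->.
have iR1 : leb3.-integrable setT _ := green_density_integrable eAR eBR M1 s1 g10.
have iR2 : leb3.-integrable setT _ := green_density_integrable eAR eBR M1 s2 g20.
have iI1 : leb3.-integrable setT _ := green_density_integrable eAI eBI M1 s1 g10.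
have iI2 : leb3.-integrable setT _ := green_density_integrable eAI eBI M1 s2 g20.
have cre : reC (fun x => opA Z 0 g x * kA Z 0 (norm3 x)) = (fun x => ka * (DR (reC g) x - DI (imC g) x)).
  by apply/funext => x; rewrite /reC opA_kA.
have cim : imC (fun x => opA Z 0 g x * kA Z 0 (norm3 x)) = (fun x => ka * (DI (reC g) x + DR (imC g) x)).
  by apply/funext => x; rewrite /imC opA_kA.
have i1 : leb3.-integrable setT (EFin \o (fun x => DR (reC g) x - DI (imC g) x) : M3 -> \bar R).
  have := @integrableB _ M3 R leb3 setT measurableT _ _ iR1 iI2.
  by apply: eq_integrable => // x _; rewrite /= EFinB.
have i2 : leb3.-integrable setT (EFin \o (fun x => DI (reC g) x + DR (imC g) x) : M3 -> \bar R).
  have := @integrableD _ M3 R leb3 setT measurableT _ _ iI1 iR2.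
  by apply: eq_integrable => // x _; rewrite /= EFinD.
have pi0 : (pi : R) != 0 by rewrite gt_eqF // pi_gt0.
split.
  rewrite /cintegrable cre cim; split.
    have := @integrableZl _ M3 R leb3 setT measurableT ka _ i1.
    by apply: eq_integrable => // x _; rewrite /= EFinM.
  have := @integrableZl _ M3 R leb3 setT measurableT ka _ i2.
  by apply: eq_integrable => // x _; rewrite /= EFinM.
rewrite /Pf /cintegral cre cim /delta0.
rewrite (@RintegralZl _ M3 R leb3 setT _ ka measurableT i1) (@RintegralZl _ M3 R leb3 setT _ ka measurableT i2).
rewrite (@RintegralB _ M3 R leb3 setT _ _ measurableT iR1 iI2) (@RintegralD _ M3 R leb3 setT _ _ measurableT iI1 iR2).
rewrite (green_density_integral eAR eBR M1 s1 g10) (green_density_integral eAI eBI M1 s2 g20).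
rewrite (green_density_integral eAI eBI M1 s1 g10) (green_density_integral eAR eBR M1 s2 g20).
rewrite /coefA /powRe /powIm expr0 /reC /imC; case: (g (0, 0, 0)) => u v /=.
have ka4 : ka * (4 * pi) = - 1 by rewrite /ka mulNr mulVf // mulf_neq0.
congr (_ +i* _).
  by transitivity (- (ka * (4 * pi)) * u); [ring|rewrite ka4 opprK mul1r].
by transitivity (- (ka * (4 * pi)) * v); [ring|rewrite ka4 opprK mul1r].
Qed.

Lemma opH_kH (g : E3 -> C) x : opH Z g x * kH Z (norm3 x) = opA Z 0 g x * kA Z 0 (norm3 x).
Proof. by rewrite opA_opH /kH expr0n /= mul0r addr0; ring. Qed.

Lemma opH_fundamental (g : E3 -> C) : test_function g ->
  cintegrable setT (fun x => opH Z g x * kH Z (norm3 x)) /\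
  Pf (fun x => kH Z (norm3 x)) (opH Z g) = delta0 g.
Proof.
move=> /opA_fundamental; rewrite /Pf.
by under [X in _ -> cintegrable _ X /\ cintegral X = _]eq_fun do rewrite opH_kH.
Qed.
End fundamental.

Theorem proposition6 (R : realType) (Z : R[i]) :
  (forall r : R, 0 < r ->
    [/\ cvgn (kA_series Z 0 r), cvgn (kA0_tail Z r) &
        kA Z 0 r = - ((4 * pi * r)^-1)%:C *
          (1 - 2 * Z * (r * ln r)%:C + limn (kA0_tail Z r))]) /\
  fundamental_solution (opA Z 0) (kA Z 0) /\
  fundamental_solution (opH Z) (kH Z).
Proof.
split; first by move=> r; exact: kA_closed.
split; split.
- exact: kA_locally_integrable.
- exact: opA_fundamental.
- exact: kH_locally_integrable.
- exact: opH_fundamental.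
Qed.
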